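(* Let $A=\|a_{ij}\|_{i,j=1}^n$ be a nonsingular real $n\times n$ matrix all of whose entries are nonnegative, and let $J$ be the $n\times n$ matrix with $J_{ij}=1$ if $i+j=n+1$ and $J_{ij}=0$ otherwise. (1) Suppose that for each $i=1,2,\ldots,n-1$ there exist numbers $r_1,r_2$ with $1\leqslant r_1,r_2\leqslant n$ such that $$a_{n-i,r_1}\cdot a_{n+1-r_1,i}>0\quad\text{and}\quad a_{n+1-i,r_2}\cdot a_{n+1-r_2,i+1}>0 .$$ Then $A$ is totally nonnegative if and only if the matrix $B=JA=\|a_{n-i+1,j}\|_{i,j=1}^n$ is sign definite of class $n^{+}$ with the signature sequence $\varepsilon_k=(-1)^{k(k-1)/2}$, $k=1,2,\ldots,n$. Moreover, in this case $B$ possesses a self-interlacing spectrum. (2) Suppose that for each $i=1,2,\ldots,n-1$ there exist numbers $r_1,r_2$ with $1\leqslant r_1,r_2\leqslant n$ such that $$a_{i,n+1-r_1}\cdot a_{r_1,n-i}>0\quad\text{and}\quad a_{i+1,n+1-r_2}\cdot a_{r_2,n+1-i}>0 .$$ Then $A$ is totally nonnegative if and only if the matrix $C=AJ=\|a_{i,n-j+1}\|_{i,j=1}^n$ is sign definite of class $n^{+}$ with the signature sequence $\varepsilon_k=(-1)^{k(k-1)/2}$, $k=1,2,\ldots,n$. Moreover, in this case $C$ possesses a self-interlacing spectrum.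
   Context: All matrices are real. A matrix is totally nonnegative if all its minors (of all orders) are nonnegative. A square $n\times n$ matrix is called sign definite of class $n$ if for every $k\leqslant n$ all its nonzero minors of order $k$ have the same sign $\varepsilon_k\in\{1,-1\}$; the sequence $\{\varepsilon_1,\ldots,\varepsilon_n\}$ is called its signature sequence. (Thus ''sign definite of class $n$ with signature sequence $\{\varepsilon_k\}$'' means that every nonzero minor of order $k$ has sign $\varepsilon_k$, for $k=1,\dots,n$.) A sign definite matrix of class $n$ is strictly sign definite of class $n$ if all its minors are different from zero. A sign definite matrix of class $n$ is said to be of class $n^{+}$ if some (positive integer) power of it is a strictly sign definite matrix of class $n$. An $n\times n$ matrix possesses a self-interlacing spectrum if its eigenvalues are real and simple and can be enumerated as $\lambda_1,\ldots,\lambda_n$ so that $\lambda_1>-\lambda_2>\lambda_3>\cdots>(-1)^{n-1}\lambda_n>0$. *)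

(* Defs.v *)
(* MathComp, with the real numbers of MathComp-Analysis ([R : realType]) in
   the theorem. *)
From HB Require Import structures.
From mathcomp Require Import all_boot all_order all_algebra.
Set Implicit Arguments.
Unset Strict Implicit.
Unset Printing Implicit Defensive.
Import Order.TTheory GRing.Theory Num.Theory.
Local Open Scope ring_scope.

Definition increasing k n (f : 'I_k -> 'I_n) : Prop :=
  forall a b : 'I_k, (a < b)%N -> (f a < f b)%N.

(* A minor of order k is [minor f g A] with [f] and [g] increasing. *)
Definition minor (R : comNzRingType) m n k
    (f : 'I_k -> 'I_m) (g : 'I_k -> 'I_n) (A : 'M[R]_(m, n)) : R :=
  \det (mxsub f g A).

Definition totally_nonnegative (R : realFieldType) m n (A : 'M[R]_(m, n)) :
    Prop :=
  forall k (f : 'I_k -> 'I_m) (g : 'I_k -> 'I_n),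
    increasing f -> increasing g -> 0 <= minor f g A.

(* Only the values [eps 1], ..., [eps n] are relevant. *)
Definition sign_definite_with (R : realFieldType) n (eps : nat -> R)
    (A : 'M[R]_n) : Prop :=
  forall k, (1 <= k <= n)%N ->
    (eps k = 1 \/ eps k = -1) /\
    forall f g : 'I_k -> 'I_n, increasing f -> increasing g ->
      minor f g A != 0 -> Num.sg (minor f g A) = eps k.

Definition sign_definite (R : realFieldType) n (A : 'M[R]_n) : Prop :=
  exists eps : nat -> R, sign_definite_with eps A.

Definition strictly_sign_definite (R : realFieldType) n (A : 'M[R]_n) : Prop :=
  sign_definite A /\
  forall k, (1 <= k <= n)%N ->
    forall f g : 'I_k -> 'I_n, increasing f -> increasing g ->
      minor f g A != 0.

(* The strictly sign definite power of [A] has its own signature sequence;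
   [eps] is the signature sequence of [A]. *)
Definition sign_definite_plus_with (R : realFieldType) n (eps : nat -> R)
    (A : 'M[R]_n) : Prop :=
  sign_definite_with eps A /\
  exists p : nat, (0 < p)%N /\ strictly_sign_definite (A ^+ p).

Definition interlacing_signature (R : realFieldType) (k : nat) : R :=
  (-1) ^+ ((k * (k - 1)) %/ 2).

(* [lambda] lists all complex eigenvalues with algebraic multiplicity, since
   the characteristic polynomial splits as the product below. Indices start
   at 0: [lambda i] is the eigenvalue number i + 1, of sign (-1) ^ i. *)
Definition self_interlacing_spectrum (R : realFieldType) n (A : 'M[R]_n) :
    Prop :=
  exists lambda : 'I_n -> R,
    [/\ char_poly A = \prod_(i < n) ('X - (lambda i)%:P),
        injective lambda,
        forall i j : 'I_n, (i < j)%N ->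
          (-1) ^+ j * lambda j < (-1) ^+ i * lambda i
      & forall i : 'I_n, 0 < (-1) ^+ i * lambda i].

(* With indices from 0, the condition i + j = n + 1 becomes i + j + 1 = n. *)
Definition exchange_mx (R : comNzRingType) n : 'M[R]_n :=
  \matrix_(i, j) ((i + j).+1 == n)%:R.

(* Main.v *)
Require Import Defs.
From HB Require Import structures.
From mathcomp Require Import all_boot all_order all_fingroup all_algebra.
From mathcomp Require Import all_classical reals topology normedtype derive.
From mathcomp Require Import ring.
Set Implicit Arguments.
Unset Strict Implicit.
Unset Printing Implicit Defensive.
Import Order.TTheory GRing.Theory Num.Theory.
Import numFieldNormedType.Exports.
Local Open Scope ring_scope.

(* With J the exchange matrix, the minors of JA of order k are those of A up
   to the sign (-1) ^ (k (k - 1) / 2). If A is totally nonnegative, then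
   (JA)^2 = (JAJ) A is totally nonnegative, nonsingular and has positive
   entries next to the diagonal, so it is oscillatory: minors whose row and
   column sets differ by one step are positive, and Cauchy-Binet chains such
   steps into the positivity of all minors of a power. For the spectrum, a
   positive left eigenvector u of JA allows one to split off the Perron root;
   the remaining matrix of size n - 1 satisfies the same sign conditions with
   the overall sign reversed, so its own Perron root has the opposite sign,
   and it is smaller in absolute value. Part (2) is part (1) for JAJ. *)

(** The obstacle is the induction on the spectrum: splitting off an eigenvalue does not visibly keep
    all minors under control. Conjugation by [L], the matrix of ones below the diagonal with columns
    weighted by [u], produces differences of neighbouring scaled columns of [L *m B]. Hence a minor
    of the smaller matrix in consecutive columns is, up to the eigenvalue and positive weights, a
    single minor of [L *m B] with one more row and one more column, the columns again being
    consecutive. Only such minors are followed. They suffice because entries are among them: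
    nonnegativity of [s *: B] yields the Perron vector, and positivity of an even power makes the
    comparison with the other eigenvalues strict. The order of minors grows by one when passing back
    to the larger matrix, and eps (k + 1) = (-1)^k eps k turns this shift into the change of sign
    between successive eigenvalues. The characteristic polynomial is factored over the reals one
    root at a time, so complex eigenvalues never have to be discussed. *)

Lemma increasing_inj k n (f : 'I_k -> 'I_n) : increasing f -> injective f.
Proof.
move=> incf a b eqf; apply/val_inj => /=.
by case: (ltngtP a b) => // /incf; rewrite eqf ltnn.
Qed.

Lemma increasing_comp k m n (f : 'I_m -> 'I_n) (g : 'I_k -> 'I_m) :
  increasing f -> increasing g -> increasing (f \o g).
Proof. by move=> incf incg a b ab; apply/incf/incg. Qed.

Lemma increasing_lift n (q : 'I_n.+1) : increasing (lift q).
Proof.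
move=> a b ab /=; rewrite /bump.
case: (leqP q a) => qa; case: (leqP q b) => qb; rewrite ?add1n ?add0n ?ltnS //.
- by have := leq_trans qa (ltnW ab); rewrite leqNgt qb.
- exact: ltnW.
Qed.

Lemma increasing_id n : increasing (@id 'I_n).
Proof. by []. Qed.

(** * The Cauchy-Binet formula and the signs that it propagates *)

Section CauchyBinet.
Variable R : comNzRingType.

Lemma det_mulmx_sum k n (A : 'M[R]_(k, n)) (B : 'M[R]_(n, k)) :
  \det (A *m B) =
  \sum_(h : {ffun 'I_k -> 'I_n}) (\prod_i A i (h i)) * \det (rowsub h B).
Proof.
rewrite /determinant.
under eq_bigr => s _ do under eq_bigr => i _ do rewrite mxE.
under eq_bigr => s _ do rewrite bigA_distr_bigA /= big_distrr /=.
rewrite exchange_big; apply: eq_bigr => h _ /=.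
rewrite big_distrr /=; apply: eq_bigr => s _.
rewrite mulrCA big_split /=; congr (_ * (_ * _)).
by apply: eq_bigr => i _; rewrite mxE.
Qed.

Lemma det_rowsub_perm k n (h : 'I_k -> 'I_n) (s : 'S_k) (B : 'M[R]_(n, k)) :
  \det (rowsub (h \o s) B) = (-1) ^+ s * \det (rowsub h B).
Proof.
rewrite -det_perm -det_mulmx -row_permE; congr (\det _).
by apply/matrixP => i j; rewrite !mxE.
Qed.

Lemma det_colsub_perm k n (h : 'I_k -> 'I_n) (s : 'S_k) (A : 'M[R]_(k, n)) :
  \det (colsub (h \o s) A) = (-1) ^+ s * \det (colsub h A).
Proof.
rewrite -det_tr -[X in _ = _ * X]det_tr !trmx_mxsub.
exact: (@det_rowsub_perm _ _ h s A^T).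
Qed.

(* The factor k! appears because the sum runs over all functions [h]. *)
Lemma cauchy_binet k n (A : 'M[R]_(k, n)) (B : 'M[R]_(n, k)) :
  \det (A *m B) *+ k`! =
  \sum_(h : {ffun 'I_k -> 'I_n}) \det (colsub h A) * \det (rowsub h B).
Proof.
(* Replacing [h] by [h \o s] costs the sign of [s] and turns the product of entries into the
   [s]-term of the determinant of [colsub h A]. Summation over all [s] then completes that
   determinant. *)
have detE (s : 'S_k) : \det (A *m B) = \sum_(h : {ffun 'I_k -> 'I_n})
    ((-1) ^+ s * \prod_i colsub h A i (s i)) * \det (rowsub h B).
  rewrite det_mulmx_sum.
  rewrite (reindex_onto (fun h : {ffun 'I_k -> 'I_n} => [ffun i => h (s i)])
            (fun h : {ffun 'I_k -> 'I_n} => [ffun i => h (s^-1%g i)])) /=; last first.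
    by move=> h _; apply/ffunP=> i; rewrite !ffunE permK.
  apply: eq_big => [h|h _].
    by apply/eqP/ffunP=> i; rewrite !ffunE permKV.
  rewrite mulrAC -det_rowsub_perm mulrC; congr (_ * _).
    by congr (\det _); apply/matrixP => i j; rewrite !mxE ffunE.
  by apply: eq_bigr => i _; rewrite !mxE ffunE.
have -> : k`! = #|{: 'S_k}| by rewrite card_Sn.
rewrite -sumr_const (eq_bigr _ (fun s _ => detE s)) exchange_big /=.
by apply: eq_bigr => h _; rewrite -big_distrl.
Qed.

End CauchyBinet.

(** Reduces the terms of Cauchy-Binet, indexed by arbitrary functions, to those with increasing
    index maps. *)
Lemma sort_injection k n (h : 'I_k -> 'I_n) : injective h ->
  exists (s : 'S_k) (h' : 'I_k -> 'I_n), increasing h' /\ h =1 h' \o s.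
Proof.
move=> injh.
pose r := relpre (val : 'I_n -> nat) leq.
pose t := [tuple h i | i < k].
have szt : size (sort r t) == k by rewrite size_sort size_tuple.
have pt : perm_eq t (Tuple szt) by rewrite perm_sym /= perm_sort.
have /tuple_permP[s Es] := pt.
exists s, (tnth (Tuple szt)); split; last first.
  move=> i /=.
  have -> : h i = tnth t i by rewrite tnth_mktuple.
  have -> : t = [tuple tnth (Tuple szt) (s j) | j < k] by exact: val_inj.
  by rewrite tnth_mktuple.
move=> a b ab.
have x0 : 'I_n := h a.
rewrite !(tnth_nth x0) /=.
have srt : sorted (relpre val ltn) (sort r t).
  rewrite -sorted_map.
  rewrite ltn_sorted_uniq_leq sorted_map sort_sorted ?andbT; last first.
    by move=> x y; apply: leq_total.
  rewrite map_inj_uniq ?sort_uniq; last exact: val_inj.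
  by rewrite map_inj_uniq // enum_uniq.
have tr : transitive (relpre (val : 'I_n -> nat) ltn).
  by move=> x y z; apply: ltn_trans.
have := @sorted_ltn_nth _ _ tr x0 _ srt a b.
by rewrite !inE size_sort size_tuple; apply.
Qed.

Section CauchyBinetSign.
Variable R : realFieldType.
Variables (k n : nat) (c : R) (A : 'M[R]_(k, n)) (B : 'M[R]_(n, k)).
Hypothesis AB_ge0 : forall h : 'I_k -> 'I_n, increasing h ->
  0 <= c * (\det (colsub h A) * \det (rowsub h B)).

(** Sorting [h] changes both determinants by the same sign, which cancels; if [h] is not injective,
    two rows coincide. *)
Let all_ge0 (h : 'I_k -> 'I_n) :
  0 <= c * (\det (colsub h A) * \det (rowsub h B)).
Proof.
have [/injectiveP injh|/injectivePn[a [b ab eqh]]] := boolP (injectiveb h).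
  have [s [h' [inch' eqh]]] := sort_injection injh.
  rewrite (eq_colsub _ eqh) (eq_rowsub _ eqh).
  by rewrite det_rowsub_perm det_colsub_perm mulrACA -signr_addb addbb mul1r AB_ge0.
suff -> : \det (rowsub h B) = 0 by rewrite !mulr0.
by apply: (determinant_alternate ab) => j; rewrite !mxE eqh.
Qed.

Let scaled : (c * \det (A *m B)) *+ k`! =
  \sum_(h : {ffun 'I_k -> 'I_n}) c * (\det (colsub h A) * \det (rowsub h B)).
Proof. by rewrite -mulrnAr cauchy_binet big_distrr. Qed.

Lemma cauchy_binet_ge0 : 0 <= c * \det (A *m B).
Proof.
rewrite -(pmulrn_lge0 _ (fact_gt0 k)) scaled.
by apply: sumr_ge0 => h _; apply: all_ge0.
Qed.

Lemma cauchy_binet_gt0 (h : 'I_k -> 'I_n) :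
  0 < c * (\det (colsub h A) * \det (rowsub h B)) -> 0 < c * \det (A *m B).
Proof.
move=> hgt0; rewrite -(pmulrn_lgt0 _ (fact_gt0 k)) scaled.
rewrite (bigD1 (finfun h)) //= ltr_pwDl //; last first.
  by apply: sumr_ge0 => ? _; apply: all_ge0.
by rewrite (eq_colsub _ (ffunE h)) (eq_rowsub _ (ffunE h)).
Qed.

End CauchyBinetSign.

Lemma eq_minor (R : comNzRingType) m n k (f f' : 'I_k -> 'I_m)
    (g g' : 'I_k -> 'I_n) (X : 'M[R]_(m, n)) :
  f =1 f' -> g =1 g' -> minor f g X = minor f' g' X.
Proof.
move=> eqf eqg; congr (\det _); apply/matrixP => i j.
by rewrite !mxE eqf eqg.
Qed.

Lemma minor_mxsub (R : comNzRingType) m n m' n' k (f : 'I_m' -> 'I_m)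
    (g : 'I_n' -> 'I_n) (f' : 'I_k -> 'I_m') (g' : 'I_k -> 'I_n')
    (X : 'M[R]_(m, n)) :
  minor f' g' (mxsub f g X) = minor (f \o f') (g \o g') X.
Proof. by rewrite /minor -mxsub_comp. Qed.

(** * Schur complements *)

(** The pivot is a parameter because the inductions below remove both the first and the last
    index. *)
Definition schur (F : fieldType) m (q : 'I_m.+1) (X : 'M[F]_m.+1) : 'M[F]_m :=
  \matrix_(i, j) (X (lift q i) (lift q j)
                  - X (lift q i) q * X q (lift q j) / X q q).

Lemma det_sparse_col (F : comNzRingType) m (q : 'I_m.+1) (Y : 'M[F]_m.+1) :
  (forall i, i != q -> Y i q = 0) ->
  \det Y = Y q q * \det (row' q (col' q Y)).
Proof.
move=> Y0; rewrite (expand_det_col _ q) (bigD1 q) //= big1 => [|i /Y0 ->].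
  by rewrite addr0 /cofactor addnn -signr_odd odd_double expr0 mul1r.
by rewrite mul0r.
Qed.

Lemma det_sparse_row (F : comNzRingType) m (q : 'I_m.+1) (Y : 'M[F]_m.+1) :
  (forall j, j != q -> Y q j = 0) ->
  \det Y = Y q q * \det (row' q (col' q Y)).
Proof.
move=> Y0; rewrite -det_tr (det_sparse_col (q := q)) => [|i /Y0]; last by rewrite mxE.
rewrite mxE -[X in _ = _ * X]det_tr; congr (_ * \det _).
by apply/matrixP => i j; rewrite !mxE.
Qed.

Lemma det_schur (F : fieldType) m (q : 'I_m.+1) (X : 'M[F]_m.+1) :
  X q q != 0 -> \det X = X q q * \det (schur q X).
Proof.
move=> Xq_neq0.
(* [E] is the elimination matrix that clears column [q] outside the pivot by subtracting multiples
   of row [q]. *)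
pose c : 'cV[F]_m.+1 := \col_i (if i == q then 0 else X i q / X q q).
pose E := 1%:M - c *m delta_mx 0 q.
have EE i j : E i j = (i == j)%:R - c i 0 * (j == q)%:R.
  by rewrite /E !mxE big_ord1 !mxE !eqxx.
have detE : \det E = 1.
  rewrite -det_tr (det_sparse_col (q := q)) => [|i iq].
    rewrite mxE EE mxE eqxx mul0r subr0 mul1r.
    have -> : row' q (col' q E^T) = 1%:M; last by rewrite det1.
    apply/matrixP => i j; rewrite mxE mxE mxE EE [RHS]mxE.
    by rewrite (inj_eq lift_inj) [lift q i == q]eq_sym
       (negbTE (neq_lift q i)) mulr0 subr0 eq_sym.
  by rewrite mxE EE mxE eqxx mul0r subr0 eq_sym (negbTE iq).
have EX i j : (E *m X) i j = X i j - c i 0 * X q j.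
  rewrite mulmxBl mul1mx -mulmxA -rowE [LHS]mxE [X in _ + X]mxE.
  by rewrite [(c *m _) _ _]mxE big_ord1 [row q X _ _]mxE.
rewrite -[LHS]mul1r -detE -det_mulmx (det_sparse_col (q := q)) => [|i iq]; last first.
  by rewrite EX mxE (negbTE iq) divfK // subrr.
rewrite EX mxE eqxx mul0r subr0; congr (_ * \det _).
apply/matrixP => i j; rewrite mxE mxE EX !mxE.
by rewrite [lift q i == q]eq_sym (negbTE (neq_lift q i)) mulrAC.
Qed.

Definition adjoin k n (p : 'I_k.+1) (q : 'I_n.+1) (f : 'I_k -> 'I_n)
    (a : 'I_k.+1) : 'I_n.+1 :=
  if unlift p a is Some b then lift q (f b) else q.

Lemma adjoin_pivot k n (p : 'I_k.+1) (q : 'I_n.+1) f : adjoin p q f p = q.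
Proof. by rewrite /adjoin unlift_none. Qed.

Lemma adjoin_lift k n (p : 'I_k.+1) (q : 'I_n.+1) f a :
  adjoin p q f (lift p a) = lift q (f a).
Proof. by rewrite /adjoin liftK. Qed.

(** Sylvester's identity for one pivot: taking the Schur complement commutes with restriction to
    index sets that contain the pivot. *)
Lemma minor_adjoin (F : fieldType) k n (p : 'I_k.+1) (q : 'I_n.+1) f g
    (X : 'M[F]_n.+1) : X q q != 0 ->
  minor (adjoin p q f) (adjoin p q g) X = X q q * minor f g (schur q X).
Proof.
move=> Xq; rewrite /minor (det_schur (q := p)) mxE !adjoin_pivot //.
congr (_ * \det _); apply/matrixP => i j.
by rewrite !mxE !adjoin_pivot !adjoin_lift.
Qed.

Lemma increasing_adjoin0 k n (f : 'I_k -> 'I_n) :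
  increasing f -> increasing (adjoin ord0 ord0 f).
Proof.
move=> incf a b; rewrite /adjoin.
case: (unliftP ord0 a) => [a' ->|->]; case: (unliftP ord0 b) => [b' ->|->] //.
by move=> ab; rewrite !lift0 ltnS incf.
Qed.

Lemma increasing_adjoin_max k n (f : 'I_k -> 'I_n) :
  increasing f -> increasing (adjoin ord_max ord_max f).
Proof.
move=> incf a b; rewrite /adjoin.
case: (unliftP ord_max a) => [a' ->|->]; case: (unliftP ord_max b) => [b' ->|->] //.
- by rewrite !lift_max => /incf.
- by rewrite !lift_max.
- by rewrite lift_max /= => kb; have := ltn_trans kb (ltn_ord b'); rewrite ltnn.
- by rewrite ltnn.
Qed.

Lemma increasing_unlift0 k n (f : 'I_k -> 'I_n.+1) :
    increasing f -> (forall a, f a != ord0) ->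
  exists f' : 'I_k -> 'I_n, increasing f' /\ f =1 lift ord0 \o f'.
Proof.
move=> incf f0.
have /fin_all_exists[f' f'E] (a : 'I_k) : exists b, f a = lift ord0 b.
  by case: (unliftP ord0 (f a)) (f0 a) => [b ->|->]; [exists b | rewrite eqxx].
exists f'; split=> // a b /incf.
by rewrite !f'E !lift0.
Qed.

(** * Total nonnegativity: corner pivots and positivity of principal minors *)

Section TotallyNonnegative.
Variable R : realFieldType.

Lemma tn_mxsub m n m' n' (X : 'M[R]_(m, n)) (f : 'I_m' -> 'I_m) (g : 'I_n' -> 'I_n) :
  increasing f -> increasing g -> totally_nonnegative X ->
  totally_nonnegative (mxsub f g X).
Proof.
move=> incf incg tnX k f' g' incf' incg'.
rewrite minor_mxsub; apply: tnX; exact: increasing_comp.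
Qed.

Lemma tn_ge0 m n (X : 'M[R]_(m, n)) i j : totally_nonnegative X -> 0 <= X i j.
Proof.
move=> tnX; have := tnX 1%N (fun=> i) (fun=> j).
rewrite /minor det_mx11 mxE; apply; move=> a b; by rewrite !ord1.
Qed.

Lemma det_mx22 (X : 'M[R]_2) :
  \det X = X ord0 ord0 * X ord_max ord_max - X ord0 ord_max * X ord_max ord0.
Proof.
rewrite (expand_det_row _ ord0) !big_ord_recl big_ord0 /cofactor.
rewrite !det_mx11 !mxE /= addr0 expr0 expr1 mul1r mulN1r mulrN.
by congr (X _ _ * X _ _ - X _ _ * X _ _); apply/val_inj.
Qed.

Lemma tn_minor2 m n (X : 'M[R]_(m, n)) (i i' : 'I_m) (j j' : 'I_n) :
    totally_nonnegative X -> (i < i')%N -> (j < j')%N ->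
  X i j' * X i' j <= X i j * X i' j'.
Proof.
move=> tnX ii jj.
have := tnX 2%N (fun a => if a == ord0 then i else i')
                (fun a => if a == ord0 then j else j').
rewrite /minor det_mx22 !mxE /= subr_ge0; apply.
  by case=> [[|[|]]] // ? [[|[|]]].
by case=> [[|[|]]] // ? [[|[|]]].
Qed.

Section Corner.
Variables (m : nat) (q : 'I_m.+1) (X : 'M[R]_m.+1).
Hypotheses (corner : (q == ord0) || (q == ord_max)).
Hypothesis tnX : totally_nonnegative X.

Lemma tn_minor2_corner i j : i != q -> j != q ->
  X i q * X q j <= X q q * X i j.
Proof.
case/orP: corner => /eqP-> iq jq; rewrite [X i _ * _]mulrC.
  by apply: tn_minor2; rewrite // lt0n.
rewrite [X in _ <= X]mulrC [X in X <= _]mulrC.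
by apply: tn_minor2; rewrite // ltn_neqAle -ltnS ltn_ord andbT.
Qed.

(** If the corner entry vanished, the 2 x 2 minors through it would force every product
    [X i q * X q j] to vanish, so row [q] or column [q] would be zero. *)
Lemma tn_corner_gt0 : X \in unitmx -> 0 < X q q.
Proof.
rewrite unitmxE unitfE => detX; rewrite lt_neqAle tn_ge0 // andbT.
apply/eqP => Xqq; case/eqP: detX.
have prod0 i j : X i q * X q j = 0.
  have [->|iq] := eqVneq i q; first by rewrite -Xqq mul0r.
  have [->|jq] := eqVneq j q; first by rewrite -Xqq mulr0.
  apply/le_anti; rewrite mulr_ge0 ?tn_ge0 // andbT.
  by have := tn_minor2_corner iq jq; rewrite -Xqq mul0r.
case: (pickP (fun j => X q j != 0)) => [j Xqj|Xq0].
  rewrite (expand_det_col _ q) big1 // => i _.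
  by have /eqP := prod0 i j; rewrite mulf_eq0 (negbTE Xqj) orbF => /eqP->; rewrite mul0r.
rewrite (expand_det_row _ q) big1 // => j _.
by have /negbFE/eqP-> := Xq0 j; rewrite mul0r.
Qed.

(** By [minor_adjoin] each minor is a bordered minor of [X] divided by the pivot; a corner pivot can
    be adjoined at the end of an index map without breaking monotonicity. *)
Lemma tn_schur : 0 < X q q -> totally_nonnegative (schur q X).
Proof.
move=> Xq k f g incf incg.
rewrite -(pmulr_rge0 _ Xq).
case/orP: corner Xq => /eqP-> Xq.
  rewrite -(minor_adjoin ord0) ?gt_eqF //.
  by apply: tnX; apply: increasing_adjoin0.
rewrite -(minor_adjoin ord_max) ?gt_eqF //.
by apply: tnX; apply: increasing_adjoin_max.
Qed.

End Corner.

Lemma unit_schur m (q : 'I_m.+1) (X : 'M[R]_m.+1) :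
  X \in unitmx -> 0 < X q q -> schur q X \in unitmx.
Proof.
move=> uX Xq; have Xq0 : X q q != 0 by rewrite gt_eqF.
by move: uX; rewrite !unitmxE !unitfE (det_schur Xq0) mulf_eq0 negb_or Xq0.
Qed.

Lemma lift0_max m (i : 'I_m) :
  lift ord0 (lift ord_max i) = lift ord_max (lift ord0 i) :> 'I_m.+2.
Proof. by apply/ord_inj; rewrite lift_max !lift0 lift_max. Qed.

(** The pivot is taken at the opposite corner: that Schur complement commutes with deletion of the
    first row and column, so the size can be lowered. *)
Lemma tn_delete0_unit m (X : 'M[R]_m.+1) : totally_nonnegative X ->
  X \in unitmx -> mxsub (lift ord0) (lift ord0) X \in unitmx.
Proof.
elim: m X => [|m IHm] X tnX uX; first by rewrite unitmxE det_mx00 unitr1.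
have Xmax : 0 < X ord_max ord_max by rewrite tn_corner_gt0 ?eqxx ?orbT.
have max_lift : lift ord0 ord_max = ord_max :> 'I_m.+2 by apply/val_inj.
rewrite unitmxE unitfE (det_schur (q := ord_max)) mxE max_lift; last first.
  by rewrite gt_eqF.
rewrite mulf_eq0 negb_or gt_eqF //=.
have -> : schur ord_max (mxsub (lift ord0) (lift ord0) X)
        = mxsub (lift ord0) (lift ord0) (schur ord_max X).
  by apply/matrixP => i j; rewrite !mxE !lift0_max max_lift.
rewrite -unitfE -unitmxE; apply: IHm.
  by apply: tn_schur => //; rewrite eqxx orbT.
exact: unit_schur.
Qed.

(** Induction on the size: the first index is deleted if [f] avoids it, and used as the pivot if [f]
    takes it. *)
Lemma tn_principal_gt0 k n (X : 'M[R]_n) (f : 'I_k -> 'I_n) :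
  totally_nonnegative X -> X \in unitmx -> increasing f -> 0 < minor f f X.
Proof.
elim: n k X f => [|n IHn] k X f tnX uX incf.
  case: k f incf => [|k] f _; first by rewrite /minor det_mx00.
  by case: (f ord0).
have [f0|/forallPn[/= a]] := boolP [forall a, f a != ord0].
  have [f' [incf' fE]] := increasing_unlift0 incf (forallP f0).
  rewrite (eq_minor _ fE fE) -minor_mxsub.
  apply: (IHn) => //; last exact: tn_delete0_unit.
  by apply: tn_mxsub => //; apply: increasing_lift.
rewrite negbK => /eqP fa0; case: k f incf a fa0 => [|k] f incf a fa0.
  by case: a {fa0}.
have f0 : f ord0 = ord0.
  apply/val_inj => /=; apply/eqP; rewrite -leqn0.
  have [->|a0] := eqVneq ord0 a; first by rewrite fa0.
  by have := incf ord0 a; rewrite fa0 lt0n eq_sym a0 => /(_ isT); rewrite ltn0.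
have [|a'|f' [incf' fE]] := @increasing_unlift0 _ _ (f \o lift ord0).
- exact/increasing_comp/increasing_lift.
- by apply/eqP => /= fa'; have := incf ord0 (lift ord0 a'); rewrite fa' ltn0; auto.
have {}fE : f =1 adjoin ord0 ord0 f'.
  move=> b; case: (unliftP ord0 b) => [b' ->|->]; first by rewrite adjoin_lift; apply: fE.
  by rewrite adjoin_pivot.
have X0 : 0 < X ord0 ord0 by rewrite tn_corner_gt0 ?eqxx.
rewrite (eq_minor _ fE fE) minor_adjoin ?gt_eqF //.
rewrite mulr_gt0 // IHn //; last exact: unit_schur.
by apply: tn_schur; rewrite ?eqxx.
Qed.

Lemma tn_mxsub_unit k n (X : 'M[R]_n) (f : 'I_k -> 'I_n) :
  totally_nonnegative X -> X \in unitmx -> increasing f ->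
  mxsub f f X \in unitmx.
Proof. by move=> *; rewrite unitmxE unitfE gt_eqF // tn_principal_gt0. Qed.

End TotallyNonnegative.

(** * Oscillatory matrices *)

Lemma lift_adjoin0 m (q : 'I_m.+1) :
  lift (lift ord0 q) =1 adjoin ord0 ord0 (lift q).
Proof.
move=> a; case: (unliftP ord0 a) => [b ->|->]; last first.
  by rewrite adjoin_pivot; apply/val_inj.
rewrite adjoin_lift; apply/val_inj => /=.
by rewrite /bump /= !add1n ltnS addnS.
Qed.

Lemma lift_adjoin_max m (q : 'I_m.+1) :
  lift (lift ord_max q) =1 adjoin ord_max ord_max (lift q).
Proof.
move=> a; case: (unliftP ord_max a) => [b ->|->]; last first.
  rewrite adjoin_pivot; apply/ord_inj; rewrite /= -/(nat_of_ord _).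
  by rewrite [bump m.+1 q]lift_max /bump -ltnS ltn_ord.
rewrite adjoin_lift; apply/ord_inj; rewrite lift_max /=.
by rewrite [bump m.+1 q]lift_max [bump m b]lift_max.
Qed.

Section Oscillatory.
Variable R : realFieldType.

(* If the entry of the Schur complement vanished, a 2 x 2 minor of [X] would
   force a diagonal entry of the Schur complement to be nonpositive. *)
Lemma schur0_super_gt0 m (X : 'M[R]_m.+1) (p q : 'I_m) :
    totally_nonnegative X -> X \in unitmx -> (p < q)%N ->
  0 < X (lift ord0 p) (lift ord0 q) -> 0 < schur ord0 X p q.
Proof.
move=> tnX uX pq Xpq.
have X0 : 0 < X ord0 ord0 by rewrite tn_corner_gt0 ?eqxx.
have tnS : totally_nonnegative (schur ord0 X) by apply: tn_schur; rewrite ?eqxx.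
have uS := unit_schur uX X0.
have Spp : 0 < schur ord0 X p p.
  have := tn_principal_gt0 (f := fun=> p) (k := 1) tnS uS.
  by rewrite /minor det_mx11 mxE; apply=> a b; rewrite !ord1.
rewrite lt_neqAle tn_ge0 // andbT; apply/eqP => /esym/eqP.
rewrite mxE subr_eq0 => /eqP Spq0.
have uv : 0 < X (lift ord0 p) ord0 * X ord0 (lift ord0 q).
  by rewrite -(pmulr_lgt0 _ (_ : 0 < (X ord0 ord0)^-1)) ?invr_gt0 // -Spq0.
have v : 0 < X ord0 (lift ord0 q).
  rewrite lt_neqAle tn_ge0 // andbT; apply/eqP => v0.
  by rewrite -v0 mulr0 ltxx in uv.
have := @tn_minor2 _ _ _ X ord0 (lift ord0 p) (lift ord0 p) (lift ord0 q) tnX.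
rewrite !lift0 ltnS => /(_ isT pq); rewrite Spq0.
rewrite [X _ ord0 * _]mulrC -mulrA mulrCA ler_pM2l //.
move: Spp; rewrite mxE subr_gt0 => Spp.
by rewrite mulrCA mulrA leNgt Spp.
Qed.

(** At this corner the contradiction falls on the diagonal entry at [q], through the minor with rows
    [p], [q] and columns [q], [ord_max]. *)
Lemma schur_max_super_gt0 m (X : 'M[R]_m.+1) (p q : 'I_m) :
    totally_nonnegative X -> X \in unitmx -> (p < q)%N ->
  0 < X (lift ord_max p) (lift ord_max q) -> 0 < schur ord_max X p q.
Proof.
move=> tnX uX pq Xpq.
have X0 : 0 < X ord_max ord_max by rewrite tn_corner_gt0 ?eqxx ?orbT.
have tnS : totally_nonnegative (schur ord_max X).
  by apply: tn_schur; rewrite ?eqxx ?orbT.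
have uS := unit_schur uX X0.
have Sqq : 0 < schur ord_max X q q.
  have := tn_principal_gt0 (f := fun=> q) (k := 1) tnS uS.
  by rewrite /minor det_mx11 mxE; apply=> a b; rewrite !ord1.
rewrite lt_neqAle tn_ge0 // andbT; apply/eqP => /esym/eqP.
rewrite mxE subr_eq0 => /eqP Spq0.
have uv : 0 < X (lift ord_max p) ord_max * X ord_max (lift ord_max q).
  by rewrite -(pmulr_lgt0 _ (_ : 0 < (X ord_max ord_max)^-1)) ?invr_gt0 // -Spq0.
have u : 0 < X (lift ord_max p) ord_max.
  rewrite lt_neqAle tn_ge0 // andbT; apply/eqP => u0.
  by rewrite -u0 mul0r ltxx in uv.
have := @tn_minor2 _ _ _ X (lift ord_max p) (lift ord_max q) (lift ord_max q)
  ord_max tnX.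
rewrite !lift_max => /(_ pq (ltn_ord _)); rewrite Spq0.
rewrite -!mulrA ler_pM2l //.
move: Sqq; rewrite mxE subr_gt0 => Sqq.
by rewrite mulrA mulrC mulrA leNgt Sqq.
Qed.

(** Every index other than [p] and [q] belongs to both index sets and can be pivoted away from a
    corner, keeping the entry at [p], [q] positive. What remains at size 2 is that entry. *)
Lemma tn_near_principal_gt0 m (X : 'M[R]_m.+1) (p q : 'I_m.+1) :
    totally_nonnegative X -> X \in unitmx -> q = p.+1 :> nat ->
  0 < X p q -> 0 < minor (lift q) (lift p) X.
Proof.
elim: m X p q => [|m IHm] X p q tnX uX qp Xpq.
  by have := ltn_ord q; rewrite qp ltnS ltn0.
case: (unliftP ord0 p) Xpq qp => [p' -> {p}|-> {p}] Xpq qp.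
  case: (unliftP ord0 q) Xpq qp => [q' ->|->] //; rewrite !lift0 => Xpq [qp].
  have X0 : 0 < X ord0 ord0 by rewrite tn_corner_gt0 ?eqxx.
  rewrite (eq_minor _ (lift_adjoin0 q') (lift_adjoin0 p')).
  rewrite minor_adjoin ?gt_eqF // mulr_gt0 // IHm //.
  - by apply: tn_schur; rewrite ?eqxx.
  - exact: unit_schur.
  - by apply: schur0_super_gt0; rewrite ?qp.
(* Here [p] is 0 and [q] is 1: either the size is 2, or the last index is a free pivot. *)
case: m IHm X q tnX uX Xpq qp => [|m] IHm X q tnX uX Xpq qp.
  have e0 : lift q =1 fun=> ord0.
    by case=> [[|//] ?]; apply/ord_inj; rewrite /= /bump qp.
  have e1 : lift ord0 =1 fun=> q by case=> [[|//] ?]; apply/ord_inj; rewrite /= qp.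
  by rewrite (eq_minor _ e0 e1) /minor det_mx11 mxE.
have Xm : 0 < X ord_max ord_max by rewrite tn_corner_gt0 ?eqxx ?orbT.
case: (unliftP ord_max q) Xpq qp => [q' ->|->] //; rewrite ?lift_max => Xpq qp.
have p0 : ord0 = lift ord_max ord0 :> 'I_m.+3 by apply/ord_inj; rewrite lift_max.
rewrite (eq_minor (g' := adjoin ord_max ord_max (lift ord0)) _ (lift_adjoin_max q'));
  last by rewrite {1}p0; apply: lift_adjoin_max.
rewrite minor_adjoin ?gt_eqF // mulr_gt0 // IHm //.
- by apply: tn_schur; rewrite ?eqxx ?orbT.
- exact: unit_schur.
- by apply: schur_max_super_gt0; rewrite -?p0 ?qp.
Qed.

Lemma minor_tr m n k (f : 'I_k -> 'I_m) (g : 'I_k -> 'I_n) (X : 'M[R]_(m, n)) :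
  minor g f X^T = minor f g X.
Proof. by rewrite /minor -trmx_mxsub det_tr. Qed.

Lemma tn_tr m n (X : 'M[R]_(m, n)) :
  totally_nonnegative X -> totally_nonnegative X^T.
Proof. by move=> tnX k f g incf incg; rewrite minor_tr tnX. Qed.

Section Raise.
Variables (k n : nat) (X : 'M[R]_n) (f f' : 'I_k -> 'I_n) (a : 'I_k).
Hypotheses (tnX : totally_nonnegative X) (uX : X \in unitmx).
Hypotheses (incf : increasing f) (incf' : increasing f').
Hypotheses (raise : f a = (f' a).+1 :> nat).
Hypothesis (same : forall b, b != a -> f b = f' b).

(** The two index sets differ in one element, so together they have k + 1 elements, listed by [T].
    In the principal submatrix on [T], omitting position a + 1 from the rows gives [f'] and omitting
    position a from the columns gives [f]. *)
Lemma minor_raise_gt0 : 0 < X (f' a) (f a) -> 0 < minor f' f X.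
Proof.
move=> Xa.
pose q : 'I_k.+1 := lift ord0 a; pose p : 'I_k.+1 := widen_ord (leqnSn k) a.
pose T b := if unlift q b is Some c then f' c else f a.
have Tq : T \o lift q =1 f' by move=> b; rewrite /T /= liftK.
have Tqq : T q = f a by rewrite /T unlift_none.
have Tp : T \o lift p =1 f.
  move=> b; rewrite [LHS]/=.
  have [->|ba] := eqVneq b a.
    by rewrite (_ : lift p a = q) //; apply/val_inj; rewrite /= /bump leqnn.
  rewrite (same ba) -(Tq b) /=; congr T; apply/val_inj => /=.
  by rewrite /bump !add1n leq_eqVlt eq_sym (inj_eq val_inj) (negbTE ba).
have qE : lift q a = p by apply/val_inj; rewrite /= /bump /= add1n ltnn.
have incT : increasing T.
  move=> x y; rewrite /T.
  case: (unliftP q x) => [c ->|->]; case: (unliftP q y) => [d ->|->] //.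
  - move=> xy; apply: incf'; move: xy; rewrite /= /bump !add1n.
    case: (ltnP a c) => ac; case: (ltnP a d) => ad; rewrite ?add1n ?add0n ?ltnS //.
      exact: ltnW.
    by move=> _; apply: leq_ltn_trans ad.
  - rewrite /= /bump !add1n; case: (ltnP a c) => ac; rewrite ?add1n ?add0n ?ltnS.
      by move=> ca; have := ltn_trans ac ca; rewrite ltnn.
    move=> _; rewrite raise ltnS.
    case: (ltngtP c a) ac => // [/incf' /ltnW //|eqca] _.
    by rewrite (val_inj eqca).
  - rewrite /= /bump !add1n; case: (ltnP a d) => ad; rewrite ?add1n ?add0n ?ltnS.
      move=> _; rewrite -same ?incf //.
      by apply/eqP => da; rewrite da ltnn in ad.
    by move=> da; have := leq_trans da ad; rewrite ltnNge leqnSn.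
  - by rewrite ltnn.
rewrite -(eq_minor X Tq Tp) -minor_mxsub.
apply: tn_near_principal_gt0 => //; first exact: tn_mxsub.
  exact: tn_mxsub_unit.
by rewrite mxE Tqq -qE -[T _]/((T \o lift q) a) Tq.
Qed.

End Raise.

Lemma minor_mulmx_ge0 m n l k (f : 'I_k -> 'I_m) (g : 'I_k -> 'I_l)
    (X : 'M[R]_(m, n)) (Y : 'M[R]_(n, l)) :
  totally_nonnegative X -> totally_nonnegative Y ->
  increasing f -> increasing g -> 0 <= minor f g (X *m Y).
Proof.
move=> tnX tnY incf incg; rewrite /minor mxsub_mul -[X in _ <= X]mul1r.
apply: cauchy_binet_ge0 => h inch; rewrite mul1r -mxsubcr -mxsubrc.
by rewrite mulr_ge0 ?tnX ?tnY.
Qed.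

Lemma minor_mulmx_gt0 m n l k (f : 'I_k -> 'I_m) (h : 'I_k -> 'I_n)
    (g : 'I_k -> 'I_l) (X : 'M[R]_(m, n)) (Y : 'M[R]_(n, l)) :
  totally_nonnegative X -> totally_nonnegative Y ->
  increasing f -> increasing g ->
  0 < minor f h X -> 0 < minor h g Y -> 0 < minor f g (X *m Y).
Proof.
move=> tnX tnY incf incg hX hY; rewrite /minor mxsub_mul -[X in _ < X]mul1r.
apply: (cauchy_binet_gt0 _ (h := h)) => [h' inch'|]; rewrite mul1r -mxsubcr -mxsubrc.
  by rewrite mulr_ge0 ?tnX ?tnY.
by rewrite mulr_gt0.
Qed.

Lemma tn_mulmx m n l (X : 'M[R]_(m, n)) (Y : 'M[R]_(n, l)) :
  totally_nonnegative X -> totally_nonnegative Y -> totally_nonnegative (X *m Y).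
Proof. by move=> tnX tnY k f g *; apply: minor_mulmx_ge0. Qed.

Lemma tn_exp n (X : 'M[R]_n) d : totally_nonnegative X -> X \in unitmx ->
  totally_nonnegative (X ^+ d.+1) /\ X ^+ d.+1 \in unitmx.
Proof.
move=> tnX uX; elim: d => [|d [tnXd uXd]]; first by rewrite expr1.
rewrite exprS; split; first exact: tn_mulmx.
by rewrite unitmx_mul uX.
Qed.

Lemma increasing_ge k n (f : 'I_k -> 'I_n) : increasing f ->
  forall a : 'I_k, (a <= f a)%N.
Proof.
move=> incf [a ak]; elim: a ak => [//|a IHa] ak.
exact: leq_ltn_trans (IHa (ltnW ak)) (incf (Ordinal (ltnW ak)) (Ordinal ak) (ltnSn a)).
Qed.

Lemma increasing_leq k n (f : 'I_k -> 'I_n) : increasing f -> (k <= n)%N.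
Proof.
by move=> /increasing_inj/leq_card; rewrite !card_ord.
Qed.

(** At the first position [a] where [f] leaves the identity one has [f a > a], while all earlier
    values equal their positions; so there is room to lower [f a] by one. *)
Lemma lower_increasing k n (f : 'I_k -> 'I_n) : increasing f ->
    ~ (forall a : 'I_k, f a = a :> nat) ->
  exists a (f' : 'I_k -> 'I_n),
    [/\ increasing f', f a = (f' a).+1 :> nat & forall b, b != a -> f b = f' b].
Proof.
move=> incf nid.
have /existsP ex : [exists a : 'I_k, f a != a :> nat].
  apply/negbNE/negP => /existsPn/= alleq; apply: nid => a.
  by have /negbNE/eqP := alleq a.
have {ex} [a fa mina] : exists2 a : 'I_k, f a != a :> nat &
    forall b : 'I_k, (b < a)%N -> f b = b :> nat.
  case: ex => a0 fa0.
  case: (@arg_minnP _ a0 (fun a => f a != a :> nat) (fun a => a) fa0).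
  move=> a fa mina.
  exists a => // b ba; apply/eqP; apply: contraLR ba => fb.
  by rewrite -leqNgt mina.
have faa : (a < f a)%N by rewrite ltn_neqAle eq_sym fa increasing_ge.
have pred_lt : ((f a).-1 < n)%N by apply: leq_ltn_trans (ltn_ord (f a)); apply: leq_pred.
have fa0 : (0 < f a)%N by apply: leq_ltn_trans faa.
pose f' b := if b == a then Ordinal pred_lt else f b.
have same b : b != a -> f b = f' b by rewrite /f' => /negbTE->.
have f'a : f a = (f' a).+1 :> nat by rewrite /f' eqxx /= prednK.
exists a, f'; split=> // x y xy.
have [ya|ya] := eqVneq y a.
  have xa : x != a by apply: contraTneq xy => ->; rewrite ya ltnn.
  rewrite -(same _ xa) ya -ltnS -f'a mina -?ya //.
  by apply: leq_ltn_trans xy _; rewrite ya.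
rewrite -(same _ ya); have [xa|xa] := eqVneq x a; last by rewrite -(same _ xa) incf.
by rewrite xa -[(f' a < _)%N]/((f' a).+1 <= _)%N -f'a ltnW // incf // -xa.
Qed.

Section Powers.
Variables (n : nat) (X : 'M[R]_n).
Hypotheses (tnX : totally_nonnegative X) (uX : X \in unitmx).
Hypothesis X_adj : forall i j : 'I_n, j = i.+1 :> nat -> 0 < X i j /\ 0 < X j i.

(** Each lowering step uses one factor [X] and decreases the sum of the indices by one, so the sum
    bounds the number of steps. If the initial segment is reached early, the remaining power
    contributes a positive principal minor. *)
Lemma minor_exp_first_gt0 d k (f : 'I_k -> 'I_n) (kn : (k <= n)%N) :
    increasing f -> (\sum_a f a <= d)%N ->
  0 < minor f (widen_ord kn) (X ^+ d.+1) /\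
  0 < minor (widen_ord kn) f (X ^+ d.+1).
Proof.
have incw : increasing (widen_ord kn) by [].
have principal e (g : 'I_k -> 'I_n) : [forall a, g a == a :> nat] ->
    0 < minor g (widen_ord kn) (X ^+ e.+1) /\
    0 < minor (widen_ord kn) g (X ^+ e.+1).
  move=> /forallP gid.
  have gE : g =1 widen_ord kn by move=> a; apply/val_inj/eqP/gid.
  have [tnXe uXe] := tn_exp e tnX uX.
  rewrite (eq_minor _ gE (frefl _)) (eq_minor _ (frefl _) gE).
  by split; apply: tn_principal_gt0.
elim: d f => [|d IHd] f incf sumf.
  apply: principal; apply/forallP => a.
  rewrite eqn_leq increasing_ge // andbT (leq_trans _ (leq0n a)) //.
  by apply: leq_trans sumf; rewrite (bigD1 a) //= leq_addr.
have [/principal //|nid] := boolP [forall a, f a == a :> nat].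
have [|a [f' [incf' f'a same]]] := lower_increasing incf.
  by move=> fid; case/forallP: nid => a; apply/eqP.
have [|IHl IHr] := IHd f' incf'.
  rewrite -ltnS; apply: leq_trans sumf.
  rewrite (bigD1 a) //= [X in (_ < X)%N](bigD1 a) //= f'a addSn ltnS leq_add2l.
  by apply: leq_sum => b /same ->.
have [tnXd uXd] := tn_exp d tnX uX.
have [up down] := X_adj f'a.
split.
  rewrite exprS; apply: minor_mulmx_gt0 IHl => //.
  rewrite -minor_tr; apply: (minor_raise_gt0 (a := a)) => //.
  - exact: tn_tr.
  - by rewrite unitmx_tr.
  - by rewrite mxE.
rewrite exprSr; apply: minor_mulmx_gt0 IHr _ => //.
exact: (minor_raise_gt0 (a := a)).
Qed.

(** The chain runs from [f] to the initial segment and on to [g]; each half has at most n * n steps,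
    since at most n indices below n are summed. *)
Lemma tn_oscillatory k (f g : 'I_k -> 'I_n) : increasing f -> increasing g ->
  0 < minor f g (X ^+ ((n * n).+1 + (n * n).+1)).
Proof.
move=> incf incg; have kn := increasing_leq incf.
have [tnXd _] := tn_exp (n * n) tnX uX.
have small (h : 'I_k -> 'I_n) : (\sum_a h a <= n * n)%N.
  apply: (@leq_trans (\sum_(a < k) n)); first by apply: leq_sum => a _; apply: ltnW.
  by rewrite sum_nat_const card_ord leq_mul2r kn orbT.
have [fl _] := minor_exp_first_gt0 kn incf (small f).
have [_ gr] := minor_exp_first_gt0 kn incg (small g).
by rewrite exprD; apply: minor_mulmx_gt0 fl gr.
Qed.

End Powers.
End Oscillatory.

(** * The Perron eigenvector *)

Section Perron.
Local Open Scope classical_set_scope.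
Local Open Scope ring_scope.
Variables (R : realType) (n : nat) (S : 'M[R]_n.+1).
Hypothesis S_ge0 : forall i j, 0 <= S i j.

Let total := \sum_i \sum_j S i j.
(* A vector [v] encodes the pair of the number [v ord0 ord0] and [vec v]. *)
Let vec (v : 'rV[R]_n.+2) : 'rV[R]_n.+1 := \row_i v ord0 (lift ord0 i).

Let coord_cont m (i : 'I_m) : continuous (fun v : 'rV[R]_m => v ord0 i).
Proof. exact: coord_continuous. Qed.

Let sum_cont m (f : 'I_m -> 'rV[R]_n.+2 -> R) :
  (forall i, continuous (f i)) -> continuous (fun v => \sum_i f i v).
Proof.
by move=> fc; apply: continuous_big => //; exact: add_continuous.
Qed.

Let slack_cont j : continuous (fun v : 'rV[R]_n.+2 =>
  \sum_i v ord0 (lift ord0 i) * S i j - v ord0 ord0 * v ord0 (lift ord0 j)).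
Proof.
move=> v; have FF : Filter (nbhs v) by exact: nbhs_filter.
apply: (@cvgB _ _ _ (nbhs v)); last by apply: (@cvgM _ _ (nbhs v)); apply: coord_cont.
apply: (sum_cont (f := fun i (v : 'rV[R]_n.+2) => v ord0 (lift ord0 i) * S i j)) => i w.
have FW : Filter (nbhs w) by exact: nbhs_filter.
by apply: (@cvgM _ _ (nbhs w)); [exact: coord_cont|exact: cvg_cst].
Qed.

(** The Collatz-Wielandt set: pairs of a number r and a vector x of the simplex with r x <= x S. The
    box only makes it compact: for r >= 0, the coordinates of x are at most 1 and summing the
    inequalities gives r <= [total], so 1 + [total] is a common bound. *)
Let feasible : set 'rV[R]_n.+2 :=
  [set v : 'rV[R]_n.+2 | (forall i, v ord0 i \in `[0, (1 + total)%R]) /\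
           (\sum_i vec v 0 i = 1) /\
           (forall j, 0 <= (vec v *m S) 0 j - v ord0 ord0 * vec v 0 j)].

Let feasible_compact : compact feasible.
Proof.
apply: (@subclosed_compact _ _
  [set v : 'rV[R]_n.+2 | forall i, v ord0 i \in `[0, (1 + total)%R]]).
- apply: closedI.
    rewrite [X in closed X](_ : _ = \bigcap_(i in setT)
        [set v : 'rV[R]_n.+2 | v ord0 i \in `[0, (1 + total)%R]]).
      apply: closed_bigI => i _.
      apply: (@preimage_closed _ _ (fun v : 'rV[R]_n.+2 => v ord0 i)
        `[0, (1 + total)%R]%classic).
        by move=> v _; apply: coord_cont.
      exact: interval_closed.
    by apply/seteqP; split=> [v H i _|v H i]; apply: H.
  apply: closedI.
    apply: (@preimage_closed _ _ (fun v : 'rV[R]_n.+2 => \sum_i vec v 0 i)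
      [set x | x = 1]).
      move=> v _; apply: sum_cont => i.
      rewrite (_ : (fun v => _) = fun v : 'rV[R]_n.+2 => v ord0 (lift ord0 i)).
        exact: coord_cont.
      by apply/funext => w; rewrite mxE.
    exact: closed_eq.
  rewrite [X in closed X](_ : _ = \bigcap_(j in setT)
      [set v : 'rV[R]_n.+2 | 0 <= (vec v *m S) 0 j - v ord0 ord0 * vec v 0 j]).
    apply: closed_bigI => j _.
    apply: (@preimage_closed _ _ (fun v : 'rV[R]_n.+2 =>
      (vec v *m S) 0 j - v ord0 ord0 * vec v 0 j) [set x | 0 <= x]).
      move=> v _.
      rewrite (_ : (fun v => _) = (fun v : 'rV[R]_n.+2 =>
        \sum_i v ord0 (lift ord0 i) * S i j - v ord0 ord0 * v ord0 (lift ord0 j))).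
        exact: slack_cont.
      apply/funext => w; rewrite !mxE; congr (_ - _).
      by apply: eq_bigr => i _; rewrite mxE.
    exact: closed_ge.
  by apply/seteqP; split=> [v H i _|v H i]; apply: H.
- apply: (@rV_compact _ _ (fun=> `[0, (1 + total)%R]%classic)).
  by move=> _; apply: segment_compact.
- by move=> v [].
Qed.
Let total_ge0 : 0 <= total.
Proof. by apply: sumr_ge0 => i _; apply: sumr_ge0. Qed.

Let feasible_pair (x : 'rV[R]_n.+1) (r : R) : 0 <= r -> (forall i, 0 <= x 0 i) ->
    \sum_i x 0 i = 1 -> (forall j, r * x 0 j <= (x *m S) 0 j) ->
  exists v, [/\ feasible v, v ord0 ord0 = r & vec v = x].
Proof.
move=> r0 x0 x1 rx.
pose v := \row_i (if unlift ord0 i is Some j then x 0 j else r) : 'rV[R]_n.+2.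
have vecv : vec v = x by apply/rowP => i; rewrite !mxE liftK.
have vr : v ord0 ord0 = r by rewrite mxE unlift_none.
have x_le1 i : x 0 i <= 1.
  by rewrite -x1 (bigD1 i) //= lerDl sumr_ge0.
have r_le : r <= total.
  rewrite -[r]mulr1 -x1 mulr_sumr (le_trans (ler_sum _ (fun j _ => rx j))) //.
  rewrite /total exchange_big; apply: ler_sum => j _; rewrite mxE.
  by apply: ler_sum => i _; rewrite ler_piMl.
exists v; split=> //; split; last by split; rewrite vecv // => j; rewrite vr subr_ge0.
move=> i; rewrite mxE in_itv /=; case: unliftP => [j|] _.
  by rewrite x0 (le_trans (x_le1 j)) // lerDl.
by rewrite r0 (le_trans r_le) // lerDr.
Qed.

Lemma perron p : (0 < p)%N -> (forall i j, 0 < (S ^+ p) i j) ->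
  exists (u : 'rV[R]_n.+1) (mu : R),
    [/\ forall i, 0 < u 0 i, 0 < mu & u *m S = mu *: u].
Proof.
move=> p_gt0 Sp.
have feas0 : (exists v, feasible v).
  have [||||v [fv _ _]] := @feasible_pair (delta_mx 0 0) 0.
  - by [].
  - by move=> i; rewrite mxE ler0n.
  - rewrite (bigD1 ord0) //= mxE !eqxx big1 ?addr0 // => i i0.
    by rewrite mxE (negbTE i0) andbF.
  - by move=> j; rewrite mul0r -rowE mxE.
  - by exists v.
have [|v fv maxv] := @compact_EVT_max _ R (fun v : 'rV[R]_n.+2 => v ord0 ord0)
    feasible feas0 feasible_compact.
  by apply: continuous_subspaceT => v; apply: coord_cont.
have {fv} [box [x1 rx]] := set_mem fv.
set r := v ord0 ord0 in rx maxv *; set x := vec v in x1 rx *.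
have r0 : 0 <= r by have := box ord0; rewrite in_itv /= => /andP[].
have x0 i : 0 <= x 0 i.
  by rewrite mxE; have := box (lift ord0 i); rewrite in_itv /= => /andP[].
have maxr (y : 'rV[R]_n.+1) s : 0 <= s -> (forall i, 0 <= y 0 i) ->
    \sum_i y 0 i = 1 -> (forall j, s * y 0 j <= (y *m S) 0 j) -> s <= r.
  move=> s0 y0 y1 sy; have [w [fw <- _]] := feasible_pair s0 y0 y1 sy.
  exact/maxv/mem_set.
have pos (z : 'rV[R]_n.+1) : (forall i, 0 <= z 0 i) -> z != 0 ->
    forall j, 0 < (z *m S ^+ p) 0 j.
  move=> z0 zn0 j.
  have [i zi] : exists i, z 0 i != 0.
    apply/existsP; apply: contraNT zn0 => /existsPn zz.
    by apply/eqP/rowP => i; rewrite mxE; apply/eqP/negbNE/zz.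
  rewrite mxE (bigD1 i) //= ltr_pwDl ?mulr_gt0 //.
    by rewrite lt_neqAle eq_sym zi z0.
  by apply: sumr_ge0 => k _; rewrite mulr_ge0 // ltW.
have xn0 : x != 0.
  apply/eqP => x_0; move: x1; rewrite x_0 big1 => [/eqP|i _]; last by rewrite mxE.
  by rewrite eq_sym oner_eq0.
(* Otherwise multiplying [x] by [S ^+ p] makes every inequality in [rx]
   strict, and [r] could be increased. *)
have eig : x *m S = r *: x.
  apply/eqP; rewrite -subr_eq0; apply: contraT => dn0.
  have y0 := pos _ x0 xn0; set y := x *m S ^+ p in y0.
  have z0 : forall j, 0 < ((x *m S - r *: x) *m S ^+ p) 0 j.
    by apply: pos => // i; have := rx i; rewrite !mxE.
  set z := _ *m _ in z0.
  have zE : z = y *m S - r *: y.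
    rewrite /z mulmxBl -scalemxAl -!mulmxA; congr (_ *m _ - _).
    exact: etrans (esym (exprS S p)) (exprSr S p).
  (* The least ratio [e] satisfies [e * y <= z] entrywise, so the normalized [y] is feasible with
     [r + e]. *)
  case: (@arg_minP _ _ _ ord0 xpredT (fun j => z 0 j / y 0 j) isT) => j0 _ minj.
  pose e := z 0 j0 / y 0 j0; have e0 : 0 < e by rewrite divr_gt0.
  pose Y := \sum_i y 0 i.
  have Y0 : 0 < Y by rewrite /Y (bigD1 ord0) //= ltr_pwDl // sumr_ge0 // => i _; apply: ltW.
  suff : r + e <= r by rewrite gerDl leNgt e0.
  apply: (maxr (Y^-1 *: y)).
  - by rewrite addr_ge0 // ltW.
  - by move=> i; rewrite mxE mulr_ge0 ?invr_ge0 // ltW.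
  - under eq_bigr do rewrite mxE.
    by rewrite -mulr_sumr mulVf // gt_eqF.
  move=> j; rewrite -scalemxAl mxE [leRHS]mxE mulrCA ler_pM2l ?invr_gt0 //.
  have : e * y 0 j <= z 0 j by rewrite -ler_pdivlMr // minj.
  have -> : z 0 j = (y *m S) 0 j - r * y 0 j.
    by rewrite zE; move: (y *m S) => w; rewrite !mxE.
  by rewrite mulrDl lerBrDl.
exists x, r.
have eigp q : x *m S ^+ q = r ^+ q *: x.
  elim: q => [|q IHq]; first by rewrite expr0 mulmx1 expr0 scale1r.
  by rewrite exprSr mulmxA IHq -scalemxAl eig scalerA exprSr.
have rx0 i : 0 < r ^+ p * x 0 i by have := pos _ x0 xn0 i; rewrite eigp mxE.
have rn0 : 0 < r.
  rewrite lt_neqAle r0 andbT eq_sym; apply/eqP => r_0.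
  by have := rx0 ord0; rewrite r_0 expr0n gtn_eqF // mul0r ltxx.
split=> // i.
by rewrite -(pmulr_rgt0 _ (exprn_gt0 p rn0)).
Qed.

End Perron.

(** * Deflation by a left eigenvector *)

Definition consecutive k n (g : 'I_k -> 'I_n) : Prop :=
  exists g0 : nat, (g0 + k <= n)%N /\ forall a, g a = (g0 + a)%N :> nat.

Lemma consecutive_increasing k n (g : 'I_k -> 'I_n) :
  consecutive g -> increasing g.
Proof. by case=> g0 [_ gE] a b; rewrite !gE ltn_add2l. Qed.

Section LowerOnes.
Variable R : realFieldType.

Definition lower_ones n : 'M[R]_n := \matrix_(i, l) (l <= i)%N%:R.

Lemma lower_ones_principal n k (f : 'I_k -> 'I_n) :
  increasing f -> minor f f (lower_ones n) = 1.
Proof.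
move=> incf; rewrite /minor det_trig; last first.
  apply/is_trig_mxP => a b /incf ab.
  by rewrite !mxE leqNgt ab.
by rewrite big1 // => a _; rewrite !mxE leqnn.
Qed.

(** If all columns but the first start below the first row, that row has at most one nonzero entry
    and the determinant expands along it. Otherwise two columns consist of ones and the minor
    vanishes. *)
Lemma tn_lower_ones n : totally_nonnegative (lower_ones n).
Proof.
elim=> [|k IHk] f h incf inch; first by rewrite /minor det_mx00 ler01.
have [alt|] := boolP [forall b : 'I_k.+1, (b != ord0) ==> (f ord0 < h b)%N].
  rewrite /minor -det_tr (det_sparse_col (q := ord0)) => [|b b0]; last first.
    by have := forallP alt b; rewrite b0 /= => fb; rewrite !mxE leqNgt fb.
  rewrite !mxE mulr_ge0 ?ler0n //.
  rewrite (_ : row' _ _ = mxsub (h \o lift ord0) (f \o lift ord0) (lower_ones n)^T);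
    last by apply/matrixP => a b; rewrite !mxE.
  rewrite -/(minor _ _ _) minor_tr; apply: IHk; apply: increasing_comp => //;
  exact: increasing_lift.
rewrite negb_forall => /existsP[b]; rewrite negb_imply -leqNgt => /andP[b0 hb].
suff -> : minor f h (lower_ones n) = 0 by [].
rewrite /minor -det_tr; apply: (determinant_alternate b0) => a; rewrite !mxE.
have f0 : (f ord0 <= f a)%N.
  by case: (eqVneq a ord0) => [->//|a0]; rewrite ltnW // incf // lt0n.
rewrite (leq_trans hb f0) (leq_trans _ (leq_trans hb f0)) //.
by rewrite ltnW // inch // lt0n.
Qed.

End LowerOnes.

Section Deflation.
Variables (R : realFieldType) (n : nat) (u : 'rV[R]_n.+1).
Hypothesis u_gt0 : forall i, 0 < u 0 i.

Definition weighted_ones : 'M[R]_n.+1 := \matrix_(i, l) ((l <= i)%N%:R * u 0 l).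
Local Notation L := weighted_ones.

Lemma weighted_onesE : L = lower_ones R n.+1 *m diag_mx u.
Proof. by rewrite mul_mx_diag; apply/matrixP => i l; rewrite !mxE. Qed.

Lemma weighted_ones_unit : L \in unitmx.
Proof.
rewrite weighted_onesE unitmx_mul !unitmxE det_diag !unitfE; apply/andP; split; last first.
  by apply/prodf_neq0 => i _; rewrite gt_eqF.
rewrite -(mxsub_id (lower_ones R n.+1)) -/(minor _ _ _).
by rewrite lower_ones_principal ?oner_eq0 //; exact: increasing_id.
Qed.

Lemma minor_weighted_ones m (f h : 'I_m -> 'I_n.+1) :
  minor f h L = minor f h (lower_ones R n.+1) * \prod_b u 0 (h b).
Proof.
rewrite /minor (_ : mxsub f h L =
    mxsub f h (lower_ones R n.+1) *m diag_mx (\row_b u 0 (h b))).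
  by rewrite det_mulmx det_diag; congr (_ * _); apply: eq_bigr => b _; rewrite mxE.
by rewrite mul_mx_diag; apply/matrixP => a b; rewrite !mxE.
Qed.

Lemma weights_gt0 m (h : 'I_m -> 'I_n.+1) : 0 < \prod_b u 0 (h b).
Proof. by apply: prodr_gt0. Qed.

(* The last row of [L] is [u], so for a left eigenvector [u] of [B] the last
   row of this conjugate is a multiple of the last unit vector. *)
Definition triangularized (B : 'M[R]_n.+1) := L *m B *m invmx L.
Definition deflation (B : 'M[R]_n.+1) : 'M[R]_n :=
  row' ord_max (col' ord_max (triangularized B)).

Lemma triangularized_mul B : triangularized B *m L = L *m B.
Proof. by rewrite mulmxKV // weighted_ones_unit. Qed.

Section Eigen.
Variables (B : 'M[R]_n.+1) (nu : R).
Hypothesis uB : u *m B = nu *: u.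
Local Notation T := (triangularized B).

Lemma triangularized_last j : T ord_max j = nu * (j == ord_max)%:R.
Proof.
have rowL : row ord_max L = u.
  by apply/rowP => l; rewrite !mxE leq_ord mul1r.
have -> : T ord_max j = row ord_max T 0 j by rewrite [RHS]mxE.
have uL : u *m invmx L = row ord_max 1%:M.
  by rewrite -(mulmxV weighted_ones_unit) row_mul rowL.
by rewrite /triangularized 2!row_mul rowL uB -scalemxAl uL [LHS]mxE !mxE eq_sym.
Qed.

Lemma char_poly_deflation : char_poly B = ('X - nu%:P) * char_poly (deflation B).
Proof.
(* Similarity is used in the form T L = L B, so that [L] is cancelled through its determinant
   instead of being inverted over polynomials. *)
have detL : \det (map_mx polyC L) != 0.
  by rewrite det_map_mx polyC_eq0 -unitfE -unitmxE weighted_ones_unit.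
have -> : char_poly B = char_poly T.
  apply: (mulIf detL); rewrite /char_poly [LHS]mulrC -!det_mulmx.
  congr (\det _); rewrite /char_poly_mx mulmxBl mulmxBr.
  by rewrite -map_mxM -map_mxM triangularized_mul scalar_mxC.
have cE i j : char_poly_mx T i j = 'X *+ (i == j) - (T i j)%:P.
  by move: (triangularized B) => M; rewrite !mxE.
rewrite /char_poly (det_sparse_row (q := ord_max)) => [|j jm].
  rewrite row'_col'_char_poly_mx; congr (_ * _).
  by rewrite cE triangularized_last eqxx mulr1.
by rewrite cE triangularized_last (negbTE jm) mulr0 eq_sym (negbTE jm) subr0.
Qed.

(** Deleting the last row and column is multiplicative because the last row of the right factor
    vanishes off the diagonal. *)
Lemma deflation_mul B1 : deflation (B1 *m B) = deflation B1 *m deflation B.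
Proof.
have TM : triangularized (B1 *m B) = triangularized B1 *m T.
  by rewrite /triangularized !mulmxA mulmxKV ?weighted_ones_unit.
apply/matrixP => i j; rewrite /deflation TM ![LHS]mxE big_ord_recr /=.
rewrite triangularized_last eq_sym (negbTE (neq_lift _ _)) !mulr0 addr0 !mxE.
apply: eq_bigr => l _; rewrite !mxE.
by have -> : widen_ord (leqnSn n) l = lift ord_max l
  by apply/ord_inj; rewrite lift_max.
Qed.

Lemma deflation1 : deflation 1%:M = 1%:M.
Proof.
apply/matrixP => i j; rewrite /deflation /triangularized mulmx1.
rewrite mulmxV ?weighted_ones_unit //.
by rewrite !mxE (inj_eq lift_inj).
Qed.

Lemma deflation_exp q : deflation (B ^+ q) = deflation B ^+ q.
Proof.
elim: q => [|q IHq]; first by rewrite !expr0 deflation1.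
by rewrite !exprSr -mulmxE deflation_mul IHq.
Qed.

Section Minors.
Variables (k : nat) (f g : 'I_k -> 'I_n) (g0 : nat).
Hypotheses (g0k : (g0 + k <= n)%N) (gE : forall a, g a = (g0 + a)%N :> nat).

Let fp : 'I_k.+1 -> 'I_n.+1 := adjoin ord_max ord_max f.
(** The run of columns [g], prolonged by one index on the right; [g0k] keeps it in range for
    [inord]. *)
Let gp (a : 'I_k.+1) : 'I_n.+1 := inord (g0 + a).

Let gpE a : gp a = (g0 + a)%N :> nat.
Proof.
by rewrite inordK // ltnS (leq_trans _ g0k) // leq_add2l -ltnS ltn_ord.
Qed.

Let gp_lift a : gp (lift ord_max a) = lift ord_max (g a).
Proof. by apply/ord_inj; rewrite gpE !lift_max gE. Qed.

(** A column of [L] in the run is a weighted indicator of a final segment of rows. On the run such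
    segments differ index by index, whereas all of them contain everything from g0 + k on, so this
    tail can be lumped into one term. *)
Let split_tail (F : 'I_n.+1 -> R) (b : 'I_k.+1) :
  \sum_i F i * (gp b <= i)%N%:R =
  \sum_c (if c == ord_max then \sum_(i < n.+1 | (g0 + k <= i)%N) F i else F (gp c))
          * (b <= c)%N%:R.
Proof.
have bk : (b <= k)%N by rewrite -ltnS ltn_ord.
pose F' i := F (inord i).
have F'E i : F i = F' i by rewrite /F' inord_val.
have sumE m : \sum_(i < n.+1 | (m <= i)%N) F i = \sum_(m <= i < n.+1) F' i.
  by rewrite big_geq_mkord; apply: eq_bigr => i _; rewrite F'E.
rewrite [RHS]big_ord_recr eqxx leq_ord mulr1 sumE.
have -> : \sum_i F i * (gp b <= i)%N%:R = \sum_(g0 + b <= i < n.+1) F' i.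
  rewrite -sumE big_mkcond [RHS]big_mkcond /=; apply: eq_bigr => i _.
  by rewrite gpE; case: ifP => _; rewrite ?mulr1 ?mulr0.
rewrite (@big_cat_nat _ _ _ (g0 + k)) ?leq_add2l //=; last exact: leqW.
congr (_ + _).
rewrite [in LHS]addnC big_addn addnC addnK big_geq_mkord /=.
rewrite [LHS]big_mkcond /=; apply: eq_bigr => c _.
have -> : (widen_ord (leqnSn k) c == ord_max) = false.
  by apply/negbTE; rewrite -val_eqE /= neq_ltn ltn_ord.
case: ifP => _; rewrite ?mulr0 ?mulr1 // /F' addnC.
by [].
Qed.

(** By [split_tail], T L = L B restricts to [P] times a triangular matrix whose determinant is the
    product of the weights. The last row of [P] is [nu] times a unit vector, and expansion along it
    leaves the minor of the deflation. *)
Lemma minor_deflation :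
  nu * minor f g (deflation B) * \prod_b u 0 (gp b) = minor fp gp (L *m B).
Proof.
pose P : 'M[R]_k.+1 := \matrix_(a, c)
  (if c == ord_max then \sum_(i < n.+1 | (g0 + k <= i)%N) T (fp a) i else T (fp a) (gp c)).
have PQ : mxsub fp gp (L *m B) = P *m mxsub gp gp L.
  rewrite -triangularized_mul; move: (T) @P => T' P.
  apply/matrixP => a b; rewrite !mxE.
  under eq_bigr do rewrite mxE mulrA.
  rewrite -mulr_suml split_tail mulr_suml; apply: eq_bigr => c _.
  by rewrite !mxE !gpE leq_add2l mulrA.
have detL : \det (mxsub gp gp L) = \prod_b u 0 (gp b).
  rewrite det_trig; first by apply: eq_bigr => b _; rewrite !mxE leqnn mul1r.
  apply/is_trig_mxP => a b ab.
  by rewrite !mxE !gpE leq_add2l leqNgt ab mul0r.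
rewrite /minor PQ det_mulmx detL; congr (_ * _).
have fpm : fp ord_max = ord_max by rewrite /fp adjoin_pivot.
have Pmm : P ord_max ord_max = nu.
  rewrite mxE eqxx fpm (bigD1 ord_max) //=.
  rewrite triangularized_last eqxx mulr1 big1 ?addr0 // => i /andP[_ im].
  by rewrite triangularized_last (negbTE im) mulr0.
have block : row' ord_max (col' ord_max P) = mxsub f g (deflation B) :> 'M_k.
  apply/matrixP => a c; rewrite /deflation /P; move: (T) => T'.
  rewrite !mxE eq_sym (negbTE (neq_lift _ _)).
  by rewrite gp_lift /fp adjoin_lift.
rewrite (det_sparse_row (q := ord_max)) => [|c cm].
  by rewrite Pmm; congr (_ * \det _); rewrite -block.
rewrite mxE (negbTE cm) fpm triangularized_last.
have -> : (gp c == ord_max) = false; last by rewrite mulr0.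
apply/negbTE; rewrite -val_eqE /= gpE neq_ltn (leq_trans _ g0k) //.
by rewrite ltn_add2l ltn_neqAle -ltnS ltn_ord andbT.
Qed.

Hypothesis incf : increasing f.

Let gp_consecutive : consecutive gp.
Proof. by exists g0; rewrite addnS ltnS. Qed.

Let scale_weights c : (0 <= c * nu * minor f g (deflation B)) =
  (0 <= c * minor fp gp (L *m B)).
Proof.
by rewrite -minor_deflation mulrA mulrA [RHS]pmulr_lge0 ?weights_gt0.
Qed.

Let scale_weights_lt c : (0 < c * nu * minor f g (deflation B)) =
  (0 < c * minor fp gp (L *m B)).
Proof.
by rewrite -minor_deflation mulrA mulrA [RHS]pmulr_lgt0 ?weights_gt0.
Qed.

(** Cauchy-Binet expands the minor of [L *m B] into minors of [B] in the consecutive columns [gp],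
    with nonnegative minors of [L] as coefficients. *)
Lemma deflation_minor_ge0 c :
    (forall h g' : 'I_k.+1 -> 'I_n.+1, increasing h -> consecutive g' ->
       0 <= c * minor h g' B) ->
  0 <= c * nu * minor f g (deflation B).
Proof.
move=> cB; rewrite scale_weights /minor mxsub_mul.
apply: cauchy_binet_ge0 => h inch; rewrite -mxsubcr -mxsubrc mulrCA.
rewrite mulr_ge0 ?cB // -/(minor _ _ _) minor_weighted_ones mulr_ge0 //.
  exact/tn_lower_ones/inch/increasing_adjoin_max.
exact/ltW/weights_gt0.
Qed.

Lemma deflation_minor_gt0 c :
    (forall h g' : 'I_k.+1 -> 'I_n.+1, increasing h -> consecutive g' ->
       0 < c * minor h g' B) ->
  0 < c * nu * minor f g (deflation B).
Proof.
move=> cB; rewrite scale_weights_lt /minor mxsub_mul.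
have incfp : increasing fp by exact: increasing_adjoin_max.
(* The strictly positive term comes from a principal minor of [L]. *)
apply: (cauchy_binet_gt0 _ (h := fp)) => [h inch|]; rewrite -mxsubcr -mxsubrc mulrCA.
  apply: mulr_ge0; last exact/ltW/cB.
  rewrite -/(minor _ _ _) minor_weighted_ones mulr_ge0 //.
    exact: tn_lower_ones.
  exact/ltW/weights_gt0.
rewrite mulr_gt0 ?cB // -/(minor _ _ _) minor_weighted_ones mulr_gt0 ?weights_gt0 //.
by rewrite lower_ones_principal.
Qed.

End Minors.

End Eigen.
End Deflation.

(** * The spectrum *)

Lemma char_poly_tr (R : comNzRingType) n (B : 'M[R]_n) :
  char_poly B^T = char_poly B.
Proof.
rewrite /char_poly -det_tr; congr (\det _).
by apply/matrixP => i j; rewrite !mxE eq_sym.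
Qed.

Lemma weighted_sum0_gt0 (R : realFieldType) n (u x : 'I_n -> R) :
    (forall i, 0 < u i) -> \sum_i u i * x i = 0 -> (exists i, x i != 0) ->
  exists i, 0 < x i.
Proof.
move=> u0 sum0 [i xi]; apply/existsP; apply: contraNT xi => /existsPn/= neg.
have : \sum_j u j * - x j = 0.
  by under eq_bigr do rewrite mulrN; rewrite sumrN sum0 oppr0.
move/eqP; rewrite psumr_eq0 => [/allP/(_ i)|j _].
  rewrite mem_index_enum => /(_ isT) /=.
  by rewrite mulf_eq0 gt_eqF // oppr_eq0.
by apply: mulr_ge0; [exact: ltW | rewrite oppr_ge0 leNgt neg].
Qed.

(** A right eigenvector [v] for [lam] is orthogonal to the positive left eigenvector [u], so it has
    entries of both signs. Cancellation then makes |B^m v| < B^m |v| in every coordinate, and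
    pairing with [u] turns the right side into nu^m times the pairing of [u] with |v|. *)
Lemma eigenvalue_lt_perron (R : realFieldType) n (B : 'M[R]_n.+1)
    (u : 'rV[R]_n.+1) (nu lam : R) m :
    (forall i, 0 < u 0 i) -> u *m B = nu *: u -> (forall i j, 0 < (B ^+ m) i j) ->
    root (char_poly B) lam -> lam != nu ->
  `|lam| ^+ m < nu ^+ m.
Proof.
move=> u0 uB Bm; rewrite -char_poly_tr -eigenvalue_root_char.
move=> /eigenvalueP[v vB vn0] lam_nu.
have uBm q : u *m B ^+ q = nu ^+ q *: u.
  elim: q => [|q IHq]; first by rewrite expr0 mulmx1 expr0 scale1r.
  by rewrite exprSr mulmxA IHq -scalemxAl uB scalerA exprSr.
have Bx : B *m v^T = lam *: v^T.
  by rewrite -[B]trmxK -trmx_mul vB linearZ.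
have Bmx q : B ^+ q *m v^T = lam ^+ q *: v^T.
  elim: q => [|q IHq]; first by rewrite expr0 mul1mx expr0 scale1r.
  by rewrite exprSr -mulmxA Bx -scalemxAr IHq scalerA exprS.
have orth : \sum_i u 0 i * v 0 i = 0.
  have : nu *: (u *m v^T) = lam *: (u *m v^T).
    by rewrite scalemxAl -uB -mulmxA Bx scalemxAr.
  move/matrixP/(_ 0 0)/eqP; rewrite !mxE -subr_eq0 -mulrBl mulf_eq0 subr_eq0.
  rewrite eq_sym (negbTE lam_nu) /= => /eqP orth; rewrite -[RHS]orth.
  by apply: eq_bigr => i _; rewrite mxE.
have [i0 vi0] : exists i, v 0 i != 0.
  apply/existsP; apply: contraNT vn0 => /existsPn zz.
  by apply/eqP/rowP => i; rewrite mxE; apply/eqP/negbNE/zz.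
have [p vp] := weighted_sum0_gt0 u0 orth (ex_intro _ i0 vi0).
have [q] : exists i, 0 < - v 0 i.
  apply: (weighted_sum0_gt0 (u := fun i => u 0 i)) => //; last by exists i0; rewrite oppr_eq0.
  by under eq_bigr do rewrite mulrN; rewrite sumrN orth oppr0.
rewrite oppr_gt0 => vq.
have strict i : `|lam| ^+ m * `|v 0 i| < \sum_j (B ^+ m) i j * `|v 0 j|.
  have -> : `|lam| ^+ m * `|v 0 i| = `|\sum_j (B ^+ m) i j * v 0 j|.
    rewrite -normrX -normrM; congr `|_|.
    have := congr1 (fun M : 'cV_n.+1 => M i 0) (Bmx m).
    rewrite /= mxE [RHS]mxE mxE => <-.
    by apply: eq_bigr => j _; rewrite mxE.
  (* The lower bound is strict because of the positive entry at [p], the upper one because of the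
     negative entry at [q]. *)
  rewrite ltr_norml; apply/andP; split.
    rewrite -subr_gt0 opprK -big_split /= (bigD1 p) //= ltr_pwDl //.
      by rewrite addr_gt0 ?mulr_gt0 ?normr_gt0 ?gt_eqF.
    apply: sumr_ge0 => j _; rewrite -mulrDr; apply: mulr_ge0; first exact: ltW.
    by rewrite -lerBlDl sub0r -normrN ler_norm.
  rewrite -subr_gt0 -sumrB (bigD1 q) //= ltr_pwDl //.
    by rewrite -mulrBr mulr_gt0 // subr_gt0 (lt_le_trans vq).
  apply: sumr_ge0 => j _; rewrite -mulrBr; apply: mulr_ge0; first exact: ltW.
  by rewrite subr_ge0 ler_norm.
pose W := \sum_i u 0 i * `|v 0 i|.
have W0 : 0 < W.
  rewrite /W (bigD1 p) //= ltr_pwDl ?mulr_gt0 ?normr_gt0 ?gt_eqF //.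
  by apply: sumr_ge0 => i _; rewrite mulr_ge0 // ltW.
rewrite -(ltr_pM2r W0) /W !mulr_sumr.
have -> : \sum_i nu ^+ m * (u 0 i * `|v 0 i|) =
          \sum_i u 0 i * \sum_j (B ^+ m) i j * `|v 0 j|.
  under [RHS]eq_bigr do rewrite mulr_sumr.
  rewrite exchange_big; apply: eq_bigr => j _.
  under [RHS]eq_bigr do rewrite mulrA.
  rewrite -mulr_suml mulrA; congr (_ * _).
  have := congr1 (fun M : 'rV_n.+1 => M 0 j) (uBm m).
  by rewrite /= !mxE => <-.
rewrite (bigD1 ord0) //= [ltRHS](bigD1 ord0) //= ltr_leD //.
  by rewrite mulrCA ltr_pM2l.
by apply: ler_sum => i _; rewrite mulrCA ler_pM2l // ltW.
Qed.

Lemma interlacing_signatureS (R : realFieldType) k :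
  interlacing_signature R k.+1 = (-1) ^+ k * interlacing_signature R k.
Proof.
rewrite /interlacing_signature -exprD -divnMDl //; congr (_ ^+ (_ %/ _)).
by case: k => // k; rewrite !subn1 -mulnDr mulnC.
Qed.

Lemma consecutive_point n (j : 'I_n) : consecutive (fun _ : 'I_1 => j).
Proof.
exists j; split; first by rewrite addn1.
by move=> a; rewrite ord1 addn0.
Qed.

Lemma minor_point (R : comNzRingType) m n (i : 'I_m) (j : 'I_n) (X : 'M[R]_(m, n)) :
  minor (fun _ : 'I_1 => i) (fun _ : 'I_1 => j) X = X i j.
Proof. by rewrite /minor det_mx11 mxE. Qed.

Lemma increasing_point n (j : 'I_n) : increasing (fun _ : 'I_1 => j).
Proof. by move=> a b; rewrite !ord1. Qed.

(* Restricting the columns to consecutive ones makes the hypotheses stable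
   under deflation, which flips the sign [s]. *)
Lemma alternating_spectrum (R : realType) m n (B : 'M[R]_n) (s : R) :
    (0 < m)%N -> s ^+ 2 = 1 ->
    (forall k (f g : 'I_k -> 'I_n), increasing f -> consecutive g ->
       0 <= s ^+ k * interlacing_signature R k * minor f g B) ->
    (forall k (f g : 'I_k -> 'I_n), increasing f -> consecutive g ->
       0 < minor f g (B ^+ (2 * m))) ->
  exists c : nat -> R,
    [/\ char_poly B = \prod_(i < n) ('X - (s * (-1) ^+ i * c i)%:P),
        forall i, (i < n)%N -> 0 < c i
      & forall i, (i.+1 < n)%N -> c i.+1 < c i].
Proof.
move=> m0; elim: n B s => [|n IHn] B s s2 Bsign Bpow.
  by exists (fun=> 1); split=> //; rewrite big_ord0 /char_poly det_mx00.
have s2m : s ^+ (2 * m) = 1 by rewrite exprM s2 expr1n.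
have Bpow_gt0 i j : 0 < (B ^+ (2 * m)) i j.
  rewrite -minor_point Bpow //; first exact: increasing_point.
  exact: consecutive_point.
have S_ge0 i j : 0 <= (s *: B) i j.
  have := Bsign 1%N (fun=> i) (fun=> j) (@increasing_point _ i) (consecutive_point j).
  by rewrite minor_point expr1 /interlacing_signature expr0 mulr1 mxE.
have [|i j|u [mu [u0 mu0 uS]]] := perron S_ge0 (p := (2 * m)%N).
- by rewrite muln_gt0.
- by rewrite exprZn s2m scale1r.
have uB : u *m B = (s * mu) *: u.
  by rewrite -scalerA -uS scalemxAr scalerA -expr2 s2 scale1r.
have s2' : (- s) ^+ 2 = 1 by rewrite sqrrN.
have nu2m : 0 < (s * mu) ^+ (2 * m) by rewrite exprMn s2m mul1r exprn_gt0.
(* The power is deflated with its own eigenvalue, which is positive, so its minors stay positive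
   without a change of sign. *)
have uBq : u *m B ^+ (2 * m) = (s * mu) ^+ (2 * m) *: u.
  elim: (2 * m)%N => [|q IHq]; first by rewrite expr0 mulmx1 expr0 scale1r.
  by rewrite exprSr mulmxA IHq -scalemxAl uB scalerA exprSr.
have [||c' [charB' c'0 c'dec]] := IHn (deflation u B) (- s) s2'.
- move=> k f g incf [g0 [g0k gE]].
  have := @deflation_minor_ge0 _ _ u u0 B (s * mu) uB k f g g0 g0k gE incf
    (s ^+ k.+1 * interlacing_signature R k.+1).
  (* The factor (-1)^k from the signature recursion is absorbed into the power of [s], which
     replaces [s] by [- s]. *)
  have -> : s ^+ k.+1 * interlacing_signature R k.+1 * (s * mu) =
            mu * ((- s) ^+ k * interlacing_signature R k).
    rewrite interlacing_signatureS.
    transitivity (s ^+ 2 * (mu * ((-1) ^+ k * s ^+ k * interlacing_signature R k))).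
      by rewrite [s ^+ k.+1]exprS; ring.
    by rewrite s2 mul1r -exprNn.
  rewrite -[mu * _ * _]mulrA (pmulr_rge0 _ mu0); apply=> h g' inch cg'; exact: Bsign.
- move=> k f g incf [g0 [g0k gE]].
  rewrite -(deflation_exp u0 uB).
  have := @deflation_minor_gt0 _ _ u u0 _ _ uBq k f g g0 g0k gE incf 1.
  rewrite mul1r (pmulr_rgt0 _ nu2m); apply=> h g' inch cg'; rewrite mul1r; exact: Bpow.
have charB := char_poly_deflation u0 uB.
exists (fun i => if i is j.+1 then c' j else mu); split.
- rewrite charB charB' big_ord_recl expr0 mulr1; congr (_ * _).
  by apply: eq_bigr => i _; rewrite lift0 exprS mulN1r mulrN mulNr.
- by case=> [//|i]; rewrite ltnS => /c'0.
case=> [|i]; rewrite ltnS => ltin; last exact: c'dec.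
have c'00 := c'0 _ ltin.
(* Only the comparison of the Perron root [mu] with the first root of the deflation is new; [lam]
   and [s * mu] have opposite signs, hence differ. *)
pose lam := - s * c' 0%N.
have rootl : root (char_poly B) lam.
  rewrite charB rootM charB'; apply/orP; right.
  by rewrite (bigD1 (Ordinal ltin)) //= rootM root_XsubC expr0 mulr1 eqxx.
have sn0 : s != 0 by apply/eqP => s0; move/eqP: s2; rewrite s0 expr0n eq_sym oner_eq0.
have lam_nu : lam != s * mu.
  rewrite /lam mulNr -mulrN (inj_eq (mulfI sn0)) lt_eqF //.
  by rewrite (lt_trans _ mu0) // oppr_lt0.
have := eigenvalue_lt_perron u0 uB Bpow_gt0 rootl lam_nu.
have s1 : `|s| = 1.
  have : (s == 1) || (s == -1) by rewrite -sqrf_eq1 s2.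
  by case/orP => /eqP->; rewrite ?normrN normr1.
rewrite /lam normrM normrN s1 mul1r (gtr0_norm c'00) exprMn s2m mul1r.
by rewrite ltr_pXn2r ?muln_gt0 ?nnegrE ?ltW.
Qed.

(** * Multiplication by the exchange matrix *)

Lemma exchange_mxE (R : comNzRingType) m n (X : 'M[R]_(m, n)) i j :
  (exchange_mx R m *m X) i j = X (rev_ord i) j.
Proof.
rewrite mxE (bigD1 (rev_ord i)) //= big1 => [|k ki]; last first.
  rewrite mxE (_ : _ == _ = false) ?mul0r //.
  apply: contraNF ki => /eqP ikm; apply/eqP/ord_inj => /=.
  by rewrite -[LHS](addKn i.+1) addSn ikm.
by rewrite mxE /= -addSn subnKC ?ltn_ord // eqxx mul1r addr0.
Qed.

Lemma exchange_mx_tr (R : comNzRingType) n : (exchange_mx R n)^T = exchange_mx R n.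
Proof. by apply/matrixP => i j; rewrite !mxE addnC. Qed.

Lemma exchange_mxK (R : comNzRingType) n : exchange_mx R n *m exchange_mx R n = 1%:M.
Proof.
apply/matrixP => i j; rewrite exchange_mxE !mxE /=.
by rewrite -addnS -[X in _ == X](subnK (ltn_ord i)) eqn_add2l eqSS eq_sym.
Qed.

Lemma det_exchange_mx (R : realFieldType) k :
  \det (exchange_mx R k) = interlacing_signature R k.
Proof.
elim: k => [|k IHk]; first by rewrite det_mx00.
rewrite interlacing_signatureS (expand_det_row _ ord0) (bigD1 ord_max) //=.
rewrite big1 ?addr0 => [|j jm]; last first.
  rewrite mxE add0n eqSS (_ : _ == _ = false) ?mul0r //.
  by apply: contraNF jm => /eqP jk; apply/eqP/ord_inj.
rewrite mxE add0n eqxx mul1r /cofactor add0n -IHk; congr (_ * \det _).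
by apply/matrixP => i j; rewrite !mxE lift0 lift_max eqSS.
Qed.

Lemma interlacing_signature_sq (R : realFieldType) k :
  interlacing_signature R k * interlacing_signature R k = 1.
Proof. by rewrite -expr2 sqrr_sign. Qed.

(** The outer reversal is the action of the exchange matrix on row indices; the inner one restores
    the increasing order, at the cost of the determinant of the exchange matrix of order k. *)
Definition conj_rev k n (f : 'I_k -> 'I_n) (a : 'I_k) : 'I_n :=
  rev_ord (f (rev_ord a)).

Lemma conj_revK k n (f : 'I_k -> 'I_n) : conj_rev (conj_rev f) =1 f.
Proof. by move=> a; rewrite /conj_rev !rev_ordK. Qed.

Lemma increasing_conj_rev k n (f : 'I_k -> 'I_n) :
  increasing f -> increasing (conj_rev f).
Proof.
have rev_lt m (i j : 'I_m) : (i < j)%N -> (rev_ord j < rev_ord i)%N.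
  by move=> ij; apply: ltn_sub2l; rewrite ?ltnS // (leq_trans _ (ltn_ord j)).
by move=> incf a b ab; apply/rev_lt/incf/rev_lt.
Qed.

Section Exchange.
Variable R : realFieldType.
Local Notation J := (exchange_mx R).
Local Notation eps := (interlacing_signature R).

Lemma minor_exchange m n k (f : 'I_k -> 'I_m) (g : 'I_k -> 'I_n) (X : 'M[R]_(m, n)) :
  minor f g (J m *m X) = eps k * minor (conj_rev f) g X.
Proof.
rewrite -det_exchange_mx /minor -det_mulmx; congr (\det _).
by apply/matrixP => a b; rewrite mxE !exchange_mxE mxE /conj_rev rev_ordK.
Qed.

Lemma exchange_unit n : J n \in unitmx.
Proof. by rewrite unitmxE det_exchange_mx unitrX // unitrN1. Qed.

Lemma tn_exchange_sandwich n (A : 'M[R]_n) :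
  totally_nonnegative A -> totally_nonnegative (J n *m A *m J n).
Proof.
move=> tnA k f g incf incg.
rewrite -mulmxA minor_exchange -minor_tr trmx_mul exchange_mx_tr minor_exchange.
rewrite mulrA interlacing_signature_sq mul1r minor_tr.
by apply: tnA; apply: increasing_conj_rev.
Qed.

Lemma tn_exchangeP n (A : 'M[R]_n) : totally_nonnegative A <->
  forall k (f g : 'I_k -> 'I_n), increasing f -> increasing g ->
    0 <= eps k * minor f g (J n *m A).
Proof.
split=> [tnA|H] k f g incf incg.
  rewrite minor_exchange mulrA interlacing_signature_sq mul1r.
  exact/tnA/incg/increasing_conj_rev.
have := H k _ g (increasing_conj_rev incf) incg.
rewrite minor_exchange mulrA interlacing_signature_sq mul1r.
by rewrite (eq_minor _ (conj_revK f) (frefl g)).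
Qed.

End Exchange.

(** * Part (1): the equivalence and the spectrum for [J *m A] *)

Section Main.
Variables (R : realType) (n : nat) (A : 'M[R]_n).
Local Notation J := (exchange_mx R n).
Local Notation eps := (interlacing_signature R).
Hypothesis A_unit : A \in unitmx.
Hypothesis A_linked : forall i j : 'I_n, j = i.+1 :> nat ->
  exists r1 r2 : 'I_n,
    0 < A (rev_ord j) r1 * A (rev_ord r1) i /\
    0 < A (rev_ord i) r2 * A (rev_ord r2) j.

Let m := ((n * n).+1 + (n * n).+1)%N.

(** The two products in [A_linked] are summands of the entries (j, i) and (i, j) of the square of
    [J *m A], whose summands are all nonnegative; so the square is positive next to the diagonal. *)
Let power_minors_gt0 : totally_nonnegative A ->
  forall k (f g : 'I_k -> 'I_n), increasing f -> increasing g ->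
    0 < minor f g ((J *m A) ^+ (2 * m)).
Proof.
move=> tnA k f g incf incg; rewrite exprM expr2 -mulmxE.
apply: tn_oscillatory => //.
- by rewrite mulmxA; apply: tn_mulmx => //; exact: tn_exchange_sandwich.
- by rewrite !unitmx_mul A_unit exchange_unit.
have entry i j r : 0 < A (rev_ord i) r * A (rev_ord r) j ->
    0 < (J *m A *m (J *m A)) i j.
  move=> Ar; rewrite mxE (bigD1 r) //= !exchange_mxE ltr_pwDl //.
  by apply: sumr_ge0 => l _; rewrite !exchange_mxE mulr_ge0 // tn_ge0.
by move=> i j /A_linked[r1 [r2 [Ar1 Ar2]]]; split; apply: entry; eassumption.
Qed.

Lemma exchange_tn_sign_definite :
  totally_nonnegative A <-> sign_definite_plus_with eps (J *m A).
Proof.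
split=> [tnA|[sdA _]].
  split=> [k kn|]; last first.
    exists (2 * m)%N; split; first by rewrite muln_gt0 addn_gt0.
    have gt0 := power_minors_gt0 tnA.
    split=> [|k _ f g incf incg]; last by rewrite gt_eqF ?gt0.
    exists (fun=> 1) => k kn; split; first by left.
    by move=> f g incf incg _; rewrite gtr0_sg ?gt0.
  have epsE : eps k = 1 \/ eps k = -1.
    rewrite /interlacing_signature -signr_odd; case: odd; [right|left] => //.
  split=> // f g incf incg; rewrite minor_exchange.
  have minor_ge0 : 0 <= minor (conj_rev f) g A.
    exact/tnA/incg/increasing_conj_rev.
  rewrite mulf_eq0 negb_or => /andP[_ minor_n0].
  rewrite sgrM [Num.sg (minor _ _ _)]gtr0_sg ?mulr1 ?lt_neqAle ?minor_ge0
    1?eq_sym ?minor_n0 //.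
  by case: epsE => ->; rewrite ?sgrN sgr1.
apply/tn_exchangeP => k f g incf incg.
case: k f g incf incg => [|k] f g incf incg.
  by rewrite /minor det_mx00 mulr1.
have [_ /(_ f g incf incg)] := sdA k.+1 (increasing_leq incf).
have [->|n0 /(_ isT) <-] := eqVneq (minor f g (J *m A)) 0; first by rewrite mulr0.
by rewrite -normrEsg.
Qed.

Lemma exchange_tn_spectrum :
  totally_nonnegative A -> self_interlacing_spectrum (J *m A).
Proof.
move=> tnA.
have [||||c [charB c0 cdec]] := @alternating_spectrum R m n (J *m A) 1.
- by rewrite addn_gt0.
- by rewrite expr1n.
- move=> k f g incf cg; rewrite expr1n mul1r.
  by apply: (tn_exchangeP A).1 => //; exact: consecutive_increasing.
- move=> k f g incf cg; apply: power_minors_gt0 => //; exact: consecutive_increasing.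
have signK (i : nat) (x : R) : (-1) ^+ i * ((-1) ^+ i * x) = x.
  by rewrite mulrA -expr2 sqrr_sign mul1r.
have cmono i j : (i < j)%N -> (j < n)%N -> c j < c i.
  elim: j => // j IHj; rewrite ltnS leq_eqVlt => /predU1P[->|ij] jn; first exact: cdec.
  exact: lt_trans (cdec _ jn) (IHj ij (ltnW jn)).
exists (fun i : 'I_n => (-1) ^+ i * c i); split.
- by rewrite charB; apply: eq_bigr => i _; rewrite mul1r.
- have neq (i j : 'I_n) : (i < j)%N -> (-1) ^+ i * c i <> (-1) ^+ j * c j.
    move=> ij /(congr1 Num.norm).
    rewrite !normrM !normr_sign !mul1r !gtr0_norm ?c0 // => cij.
    by have := cmono _ _ ij (ltn_ord j); rewrite cij ltxx.
  move=> i j eq_ij; apply/ord_inj.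
  by case: (ltngtP i j) => // /neq; rewrite eq_ij.
- by move=> i j ij; rewrite !signK cmono.
- by move=> i; rewrite signK c0.
Qed.

End Main.

(* Indices start at 0, so [rev_ord r] stands for n + 1 - r, and the pair of
   consecutive indices i, j stands for i, i + 1; thus n - i is [rev_ord j]. *)
Theorem theorem2p8 (R : realType) (n : nat) (A : 'M[R]_n)
    (A_unit : A \in unitmx)
    (A_ge0 : forall i j : 'I_n, 0 <= A i j) :
  ((forall i j : 'I_n, j = i.+1 :> nat ->
      exists r1 r2 : 'I_n,
        0 < A (rev_ord j) r1 * A (rev_ord r1) i /\
        0 < A (rev_ord i) r2 * A (rev_ord r2) j) ->
   (totally_nonnegative A <->
      sign_definite_plus_with (@interlacing_signature R)
        (exchange_mx R n *m A)) /\
   (totally_nonnegative A ->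
      self_interlacing_spectrum (exchange_mx R n *m A)))
  /\
  ((forall i j : 'I_n, j = i.+1 :> nat ->
      exists r1 r2 : 'I_n,
        0 < A i (rev_ord r1) * A r1 (rev_ord j) /\
        0 < A j (rev_ord r2) * A r2 (rev_ord i)) ->
   (totally_nonnegative A <->
      sign_definite_plus_with (@interlacing_signature R)
        (A *m exchange_mx R n)) /\
   (totally_nonnegative A ->
      self_interlacing_spectrum (A *m exchange_mx R n))).
Proof.
split; first by split; [exact: exchange_tn_sign_definite | exact: exchange_tn_spectrum].
move=> A_linked; pose J := exchange_mx R n.
have JJ : J *m J = 1%:M by exact: exchange_mxK.
have JAJ : J *m (J *m A *m J) = A *m J by rewrite !mulmxA JJ mul1mx.
have AE : J *m (J *m A *m J) *m J = A by rewrite JAJ -mulmxA JJ mulmx1.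
have tnE : totally_nonnegative A <-> totally_nonnegative (J *m A *m J).
  split; first exact: tn_exchange_sandwich.
  by move=> /tn_exchange_sandwich; rewrite AE.
have A'E i j : (J *m A *m J) i j = A (rev_ord i) (rev_ord j).
  rewrite -mulmxA exchange_mxE -[A *m J]trmxK mxE trmx_mul exchange_mx_tr.
  by rewrite exchange_mxE mxE.
have unitA' : J *m A *m J \in unitmx by rewrite !unitmx_mul A_unit exchange_unit.
have linked' (i j : 'I_n) : j = i.+1 :> nat -> exists r1 r2 : 'I_n,
    0 < (J *m A *m J) (rev_ord j) r1 * (J *m A *m J) (rev_ord r1) i /\
    0 < (J *m A *m J) (rev_ord i) r2 * (J *m A *m J) (rev_ord r2) j.
  (* Reversal of both indices interchanges the two conditions, hence the swapped witnesses. *)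
  move=> /A_linked[r1 [r2 [Ar1 Ar2]]]; exists r2, r1.
  by rewrite !A'E !rev_ordK.
rewrite tnE -JAJ; split; first exact: exchange_tn_sign_definite.
exact: exchange_tn_spectrum.
Qed.
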